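(* Suppose that $\mu\in\mathcal S^+$, let $\nu\in\mathcal S^+$ be the unique solution of the fluid problem whose initial condition is the null measure, and let $\xi=\mu-\nu$ (a function of time with values in the finite, a priori signed, measures on $\mathbb R_+^2$). Then, for each $t\ge 0$, $\xi_t\in\mathcal M_F^+(\mathbb R_+^2)$ (so $\xi_t$ is nonnegative), $\xi_t(U_g^c)=0$, and the $y$-marginal $A\mapsto\xi_t(\mathbb R_+\times A)$ is absolutely continuous with respect to Lebesgue measure. Also, $$\int_0^t\langle\bar r(\mu_s)h_g^x+h_g^y,\xi_s\rangle\,ds<\infty\qquad\text{for all }t\ge 0,$$ and for each $t\ge 0$ and $\varphi\in C_c^1(\mathbb R_+^3)$, $$\langle\varphi_t,\xi_t\rangle=\langle\varphi_0,\xi_0\rangle-\int_0^t\langle\varphi_s[\bar r(\mu_s)h_g^x+h_g^y],\xi_s\rangle\,ds+\int_0^t\langle\partial_t\varphi_s+\bar r(\mu_s)\partial_x\varphi_s+\partial_y\varphi_s,\xi_s\rangle\,ds .$$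
   Context: **Notation.** $\mathbb R_+=[0,\infty)$; $\inf\emptyset=\infty$; $\mathbf 1\{\cdot\}$ is an indicator. $\mathcal M_F^+(\mathbb R_+^2)$ is the space of finite nonnegative Borel measures on $\mathbb R_+^2$ with the weak topology; $\langle f,\mu\rangle=\int f\,d\mu$. $D_S[0,\infty)$ is the space of càdlàg functions $[0,\infty)\to S$. $C_c^1(\mathbb R_+^3)$ is the set of compactly supported continuously differentiable functions on $\mathbb R_+^3$ (one-sided derivatives on the boundary); values are written $\varphi_t(x,y)$. **Data and standing assumptions.** $\lambda_0>0$ is a constant and $g:\mathbb R_+^2\to\mathbb R_+$ is a probability density. $S_g(x,y)=\int_{[x,\infty)\times[y,\infty)}g(u,v)\,du\,dv$, $U_g=\{(x,y)\in\mathbb R_+^2:S_g(x,y)>0\}$, $U_g^c=\mathbb R_+^2\setminus U_g$. It is assumed that $g$ is locally bounded in $U_g$ (each $z\in U_g$ has a relatively open neighborhood $U\subset U_g$ in $\mathbb R_+^2$ on which $g$ is bounded) and that $S_g$ is continuously differentiable. The hazard rate vector field is $h_g=(h_g^x,h_g^y)=-\nabla\log S_g$ on $U_g$ and $h_g=0$ outside $U_g$. **Fluid problem.** For $\mu\in\mathcal M_F^+(\mathbb R_+^2)$ let $\bar y_*(\mu)=\inf\{y\ge 0:\mu(\mathbb R_+\times[0,y])\ge 1\}$ and $\bar r(\mu,y)=\mathbf 1\{y\le\bar y_*(\mu)\}$; $\bar r(\mu)$ denotes the function $(x,y)\mapsto\bar r(\mu,y)$. $\mathcal S^+$, the set of solutions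 of the fluid problem, consists of all $\mu\in D_{\mathcal M_F^+(\mathbb R_+^2)}[0,\infty)$ such that: (a) $\mu_t(U_g^c)=0$ for all $t\ge 0$; (b) the $y$-marginal $A\mapsto\mu_t(\mathbb R_+\times A)$ is absolutely continuous with respect to Lebesgue measure for all $t\ge 0$; (c) $\int_0^t\langle\bar r(\mu_s)h_g^x+h_g^y,\mu_s\rangle\,ds<\infty$ for all $t\ge 0$; (d) for all $t\ge 0$ and $\varphi\in C_c^1(\mathbb R_+^3)$, $$\langle\varphi_t,\mu_t\rangle=\langle\varphi_0,\mu_0\rangle+\lambda_0\int_0^t\varphi_s(0,0)\,ds-\int_0^t\langle\varphi_s[\bar r(\mu_s)h_g^x+h_g^y],\mu_s\rangle\,ds+\int_0^t\langle\partial_t\varphi_s+\bar r(\mu_s)\partial_x\varphi_s+\partial_y\varphi_s,\mu_s\rangle\,ds .$$ It is known that there is exactly one $\nu\in\mathcal S^+$ with $\nu_0$ the null measure. *)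

(* Defs.v *)
From HB Require Import structures.
From mathcomp Require Import all_boot all_order all_algebra.
From mathcomp Require Import all_classical all_reals all_analysis.
Import Order.TTheory GRing.Theory Num.Theory.
Import numFieldNormedType.Exports.

Set Implicit Arguments.
Unset Strict Implicit.
Unset Printing Implicit Defensive.

Local Open Scope classical_set_scope.
Local Open Scope ring_scope.

Definition Rplus (R : realType) : set R := `[0, +oo[.

Definition quadrant (R : realType) : set (R * R) := @Rplus R `*` @Rplus R.

Definition octant (R : realType) : set (R * (R * R)) :=
  @Rplus R `*` @quadrant R.

Arguments Rplus {R}.
Arguments quadrant {R}.
Arguments octant {R}.

(* Functions on [0, oo), [0, oo)^2 and [0, oo)^3 are represented by functions
   on R, R * R and R * (R * R) of which only the values on these sets matter.
   Increments are therefore restricted to points of [0, oo): the derivative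
   is two-sided at a > 0 and one-sided at a = 0. *)
Definition diff_quot (R : realType) (f : R -> R) (a u : R) : R :=
  (f u - f a) / (u - a).

Definition derivable_plus (R : realType) (f : R -> R) (a : R) : Prop :=
  cvg (diff_quot f a @ within Rplus a^').

Definition derive_plus (R : realType) (f : R -> R) (a : R) : R :=
  lim (diff_quot f a @ within Rplus a^').

Definition pdx (R : realType) (f : R * R -> R) (z : R * R) : R :=
  derive_plus (fun u => f (u, z.2)) z.1.

Definition pdy (R : realType) (f : R * R -> R) (z : R * R) : R :=
  derive_plus (fun v => f (z.1, v)) z.2.

Definition C1_quadrant (R : realType) (f : R * R -> R) : Prop :=
  [/\ {within quadrant, continuous f},
      forall z, quadrant z ->
        derivable_plus (fun u => f (u, z.2)) z.1 /\
        derivable_plus (fun v => f (z.1, v)) z.2,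
      {within quadrant, continuous (pdx f)} &
      {within quadrant, continuous (pdy f)}].

Section test_functions.
Context {R : realType}.
Implicit Types (phi : R * (R * R) -> R) (p : R * (R * R)).

Definition phi_t phi p : R := derive_plus (fun s => phi (s, p.2)) p.1.
Definition phi_x phi p : R := pdx (fun z => phi (p.1, z)) p.2.
Definition phi_y phi p : R := pdy (fun z => phi (p.1, z)) p.2.

Definition C1c_octant phi : Prop :=
  [/\ {within octant, continuous phi},
      forall s x y, octant (s, (x, y)) ->
        [/\ derivable_plus (fun u => phi (u, (x, y))) s,
            derivable_plus (fun u => phi (s, (u, y))) x &
            derivable_plus (fun u => phi (s, (x, u))) y],
      [/\ {within octant, continuous (phi_t phi)},
          {within octant, continuous (phi_x phi)} &
          {within octant, continuous (phi_y phi)}] &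
      compact (closure [set p | octant p /\ phi p != 0])].

End test_functions.

(* The underlying type is R * R; the product of the Borel sigma-algebras is the
   Borel sigma-algebra of the plane. *)
Definition plane (R : realType) := (measurableTypeR R * measurableTypeR R)%type.

(* Finite Borel measures on [0, oo)^2, as finite Borel measures on R^2 that
   do not charge the complement. *)
Record MFplus (R : realType) := {
  mf_measure :> {finite_measure set (plane R) -> \bar R} ;
  mf_carried : mf_measure (~` quadrant) = 0%E }.

Definition bracket (R : realType) (f : R * R -> R) (m : MFplus R) : \bar R :=
  (\int[m]_(z in quadrant) (f z)%:E)%E.

Definition weak_cvg (R : realType) (F : set_system R) (mu : R -> MFplus R)
    (m : MFplus R) : Prop :=
  forall f : R * R -> R,
    {within quadrant, continuous f} -> [bounded f z | z in quadrant] ->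
    (fun s => bracket f (mu s)) @ F --> bracket f m.

(* Only the restriction of a path to times t >= 0 is meaningful. *)
Definition cadlag (R : realType) (mu : R -> MFplus R) : Prop :=
  (forall t : R, 0 <= t -> weak_cvg t^'+ mu (mu t)) /\
  (forall t : R, 0 < t -> exists m : MFplus R, weak_cvg t^'- mu m).

Definition ymarginal_ac (R : realType) (m : MFplus R) : Prop :=
  (fun A : set (measurableTypeR R) => m (Rplus `*` A)) `<< @lebesgue_measure R.

Section data.
Context {R : realType}.
Context (g : R * R -> R).

Definition leb2 : {measure set (plane R) -> \bar R} :=
  (@lebesgue_measure R \x @lebesgue_measure R)%E.

Definition is_density : Prop :=
  [/\ measurable_fun (quadrant : set (plane R)) (g : plane R -> R),
      forall z, quadrant z -> 0 <= g z &
      (\int[leb2]_(z in quadrant) (g z)%:E = 1)%E].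

Definition Sg (z : R * R) : R :=
  \int[leb2]_(w in `[z.1, +oo[ `*` `[z.2, +oo[) g w.

Definition Ug : set (R * R) := [set z | quadrant z /\ 0 < Sg z].

Definition Ugc : set (R * R) := quadrant `\` Ug.

Definition locally_bounded_in_Ug : Prop :=
  forall z, Ug z -> exists O : set (R * R),
    [/\ open O, O z, O `&` quadrant `<=` Ug &
        [bounded g w | w in O `&` quadrant]].

Definition hgx (z : R * R) : R :=
  if z \in Ug then - pdx (fun w => ln (Sg w)) z else 0.

Definition hgy (z : R * R) : R :=
  if z \in Ug then - pdy (fun w => ln (Sg w)) z else 0.

End data.

Section fluid_problem.
Context {R : realType}.

Definition ystar (m : MFplus R) : \bar R :=
  ereal_inf [set y%:E | y in
    [set y : R | 0 <= y /\ (1 <= m (Rplus `*` `[0%R, y]))%E]].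

Definition rbar (m : MFplus R) (y : R) : R := (y%:E <= ystar m)%E%:R.

Definition hazard (g : R * R -> R) (m : MFplus R) (z : R * R) : R :=
  rbar m z.2 * hgx g z + hgy g z.

Definition transport (m : MFplus R) (phi : R * (R * R) -> R) (s : R)
    (z : R * R) : R :=
  phi_t phi (s, z) + rbar m z.2 * phi_x phi (s, z) + phi_y phi (s, z).

(* Brackets are extended reals: for given s the bracket with the hazard rate
   may be infinite; finiteness of its time integral is a separate clause. *)
Definition solution (lambda0 : R) (g : R * R -> R) (mu : R -> MFplus R)
    : Prop :=
  cadlag mu /\
  [/\ forall t : R, 0 <= t -> mu t (Ugc g) = 0%E,
      forall t : R, 0 <= t -> ymarginal_ac (mu t),
      forall t : R, 0 <= t ->
        (\int[lebesgue_measure]_(s in `[0%R, t])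
           bracket (hazard g (mu s)) (mu s) < +oo)%E &
      forall (t : R) (phi : R * (R * R) -> R), 0 <= t -> C1c_octant phi ->
        (bracket (fun z => phi (t, z)) (mu t) =
         bracket (fun z => phi (0%R, z)) (mu 0%R)
         + lambda0%:E *
           \int[lebesgue_measure]_(s in `[0%R, t])
             (phi (s, (0%R, 0%R)))%:E
         - \int[lebesgue_measure]_(s in `[0%R, t])
             bracket (fun z => phi (s, z) * hazard g (mu s) z)%R (mu s)
         + \int[lebesgue_measure]_(s in `[0%R, t])
             bracket (transport (mu s) phi s) (mu s))%E].

Definition null_at_0 (mu : R -> MFplus R) : Prop :=
  forall A : set (plane R), measurable A -> mu 0 A = 0%E.

Definition unique_null_solution (lambda0 : R) (g : R * R -> R)
    (nu : R -> MFplus R) : Prop :=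
  [/\ solution lambda0 g nu, null_at_0 nu &
      forall nu' : R -> MFplus R, solution lambda0 g nu' -> null_at_0 nu' ->
        forall t : R, 0 <= t -> forall A : set (plane R), measurable A ->
          nu' t A = nu t A].

End fluid_problem.

(* Main.v *)
Require Import Defs.
From HB Require Import structures.
From mathcomp Require Import all_boot all_order all_algebra.
From mathcomp Require Import all_classical all_reals all_analysis.
From mathcomp Require Import measurable_realfun ring lra.
Import Order.TTheory GRing.Theory Num.Theory.
Import numFieldNormedType.Exports.
Local Open Scope classical_set_scope.
Local Open Scope ring_scope.

(* Younger mass has priority, so the mass that arrived after time 0, which at
   time t sits in {y < t}, does not feel the initial mass, which sits in
   {y >= t}. The restriction of mu_t to {y < t} therefore solves the fluid
   problem with null initial condition: test the equation with
   phi_s(x, y) eta(s - y), where the C^1 function eta vanishes on (-oo, 0] and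
   (d/dt + d/dy) eta(s - y) = 0, and let eta increase to the indicator of
   (0, oo). The service indicator is unchanged on {y < t} because ystar only
   looks at the strips [0, y]. By uniqueness the restriction is nu_t, so xi_t is
   the restriction of mu_t to {y >= t}, which is nonnegative, and its equation is
   the difference of the equations of mu and of its restriction. The restricted
   path is cadlag because the mass with 0 < t - y < epsilon is at most
   lambda0 * epsilon up to smoothing, uniformly in t. *)

Set Implicit Arguments.
Unset Strict Implicit.
Unset Printing Implicit Defensive.

(** The quantitative input is a single inequality, obtained by testing with a bounded nonnegative
    function of s - y: hazard and spatial cutoffs can only remove mass. The constant profile bounds
    the total mass on bounded time intervals; the difference of two profiles controls the mass just
    below the line y = t. Letting the profile sharpen inside the time integrals is where the work
    lies. The transport term is bounded, so the mass bound dominates it. The hazard is unbounded,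
    and the loss term is dominated by a multiple of the hazard itself, whose double integral is
    finite by clause (c). Both limits need s -> <F_s, mu_s> to be measurable, which has to be
    extracted from the right continuity of the path, including the moving threshold [ystar (mu s)].
    The source goes entirely to the young part: every initial point has 0 - y <= 0, so the profile
    erases the initial term, while mass entering at y = 0 at time s > 0 carries the weight
    [eta n s], which tends to 1. Hence the source cancels in the equation of the old part. *)

Section one_sided_derivatives.
Context {R : realType}.
Implicit Types (f g : R -> R) (a l : R).

(** The relational form of [derive_plus]: naming the limit lets the product and chain rules deliver
    existence and value together. *)
Definition is_dplus f a l : Prop := diff_quot f a @ within Rplus a^' --> l.

Lemma RplusP (x : R) : Rplus x <-> 0 <= x.
Proof. by rewrite /Rplus/= in_itv/= andbT. Qed.

Lemma near_within_Rplus a (P : R -> Prop) :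
  (forall u, 0 <= u -> u != a -> P u) -> \forall u \near within Rplus a^', P u.
Proof.
move=> h; rewrite /within/= /dnbhs /within/=.
apply: (@filterE _ (nbhs a)) => u ua /RplusP u0; exact: h.
Qed.

Lemma within_Rplus_filter a : Filter (within Rplus a^').
Proof. exact: within_filter. Qed.
#[local] Existing Instance within_Rplus_filter.

(** Right neighbourhoods of a nonnegative point stay in [Rplus], so limits along this filter are
    unique, at the boundary point 0 as well. *)
Lemma within_Rplus_proper a : 0 <= a -> ProperFilter (within Rplus a^').
Proof.
move=> a0; apply: Build_ProperFilter_ex => P HP.
suff : a^'+ P by apply: (@filter_ex _ _ (at_right_proper_filter a)).
have aP : nbhs a (fun x => x != a -> Rplus x -> P x) by [].
apply: (@filterS _ (nbhs a) _ _ _ _ aP) => x h ax.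
by apply: h; [rewrite gt_eqF|apply/RplusP; rewrite (le_trans a0)// ltW].
Qed.

Lemma is_dplus_derivable f a l : is_dplus f a l -> derivable_plus f a.
Proof. by move=> fl; apply/cvg_ex; exists l. Qed.

Lemma is_dplus_derive f a l : 0 <= a -> is_dplus f a l -> derive_plus f a = l.
Proof.
move=> a0 fl; have := within_Rplus_proper a0 => ?.
exact: cvg_lim fl.
Qed.

Lemma derivable_plus_is_dplus f a :
  derivable_plus f a -> is_dplus f a (derive_plus f a).
Proof. by []. Qed.

Lemma cvg_within_Rplus (h k : R -> R) a l :
  (forall u, 0 <= u -> u != a -> h u = k u) ->
  h @ within Rplus a^' --> l -> k @ within Rplus a^' --> l.
Proof.
move=> hk; apply: cvg_trans; apply: near_eq_cvg.
by apply: near_within_Rplus.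
Qed.

Lemma is_dplus_affine (b c a : R) : is_dplus (fun u => b + c * u) a c.
Proof.
apply: (@cvg_within_Rplus (fun=> c)); last exact: cvg_cst.
move=> u _ ua; rewrite /diff_quot.
have ua0 : u - a != 0 by rewrite subr_eq0.
by field.
Qed.

Lemma within_Rplus_cvg_id a : (fun u => u) @ within Rplus a^' --> a.
Proof. by move=> A nA; apply: cvg_within; exact: nbhs_dnbhs. Qed.

Lemma is_dplus_cvg f a l : is_dplus f a l -> f @ within Rplus a^' --> f a.
Proof.
move=> fl; apply: (@cvg_within_Rplus (fun u => f a + diff_quot f a u * (u - a))).
  move=> u _ ua; have ua0 : u - a != 0 by rewrite subr_eq0.
  by rewrite /diff_quot; field.
rewrite -[X in _ --> X]addr0 -(mulr0 l) -(subrr a).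
apply: cvgD; first exact: cvg_cst.
apply: cvgM; first exact: fl.
by apply: cvgB; [exact: within_Rplus_cvg_id|exact: cvg_cst].
Qed.

Lemma is_dplusM f g a l m : is_dplus f a l -> is_dplus g a m ->
  is_dplus (fun u => f u * g u) a (l * g a + f a * m).
Proof.
move=> fl gm; apply: (@cvg_within_Rplus
  (fun u => diff_quot f a u * g u + f a * diff_quot g a u)).
  move=> u _ ua; have ua0 : u - a != 0 by rewrite subr_eq0.
  by rewrite /diff_quot; field.
apply: cvgD; first by apply: cvgM; [exact: fl|exact: (is_dplus_cvg gm)].
by apply: cvgM; [exact: cvg_cst|exact: gm].
Qed.

(** The slope function of Carathéodory avoids dividing by [f u - f a], which may vanish for u
    arbitrarily close to a. *)
Lemma is_dplus_comp f (F : R -> R) a l d :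
  is_dplus f a l -> is_derive (f a) 1 F d -> is_dplus (F \o f) a (d * l).
Proof.
move=> fl /is_derive1_caratheodory[G [FG cG <-]].
apply: (@cvg_within_Rplus (fun u => G (f u) * diff_quot f a u)).
  by move=> u _ ua; rewrite /diff_quot/= FG mulrA.
apply: cvgM; last exact: fl.
apply: continuous_cvg; [exact: cG|exact: is_dplus_cvg fl].
Qed.

Lemma is_dplus_le0 f a l : 0 <= a ->
  (forall x y, 0 <= x -> x <= y -> f y <= f x) -> is_dplus f a l -> l <= 0.
Proof.
move=> a0 fdec fl; have := within_Rplus_proper a0 => ?.
apply: (cvgr_to_le fl); apply: near_within_Rplus => u u0 ua.
have [au|ua'] := leP a u.
  by rewrite /diff_quot mulr_le0_ge0 ?subr_le0 ?invr_ge0 ?subr_ge0// fdec.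
by rewrite /diff_quot mulr_ge0_le0 ?invr_le0 ?subr_ge0 ?subr_le0 ?fdec// ltW.
Qed.

End one_sided_derivatives.

(** * Explicit C^1 profiles and cutoffs on the line *)

Section plateau_functions.
Context {R : realType}.

(** The square of the positive part is C^1 across 0 and vanishes on a half line; both the profiles
    [eta] and the cutoffs are built from it. *)
Definition pos_sqr (u : R) : R := Num.max u 0 ^+ 2.

Lemma pos_sqr_ge0 u : 0 <= pos_sqr u.
Proof. exact: sqr_ge0. Qed.

Lemma pos_sqr_le u v : u <= v -> pos_sqr u <= pos_sqr v.
Proof.
move=> uv; rewrite /pos_sqr ler_sqr ?nnegrE ?le_max ?lexx ?orbT//.
by case: (leP u 0) (leP v 0) uv => [u0|u0] [v0|v0] //; lra.
Qed.

Lemma pos_sqr_eq0 u : u <= 0 -> pos_sqr u = 0.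
Proof. by move=> u0; rewrite /pos_sqr max_r// expr0n. Qed.

Lemma pos_sqrE u : 0 <= u -> pos_sqr u = u ^+ 2.
Proof. by move=> u0; rewrite /pos_sqr max_l. Qed.

Lemma is_derive_pos_sqr (u : R) : is_derive u (1 : R) pos_sqr (2 * Num.max u 0).
Proof.
have [u0|u0|->] := ltgtP u 0.
- rewrite mulr0; apply: (@near_eq_is_derive _ _ _ (fun=> 0)).
  + near=> v; rewrite pos_sqr_eq0//; apply: ltW; near: v.
    exact: lt_nbhsl.
- have dX : is_derive u (1 : R) (fun v : R => v * v) (2 * u).
    apply/is_derive1_caratheodory; exists (fun v => v + u); split.
    + by move=> v; ring.
    + by apply: cvgD; [exact: cvg_id|exact: cvg_cst].
    + by ring.
  apply: (@near_eq_is_derive _ _ _ (fun v : R => v * v)) dX.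
  + near=> v; rewrite pos_sqrE ?expr2//; apply: ltW; near: v.
    exact: lt_nbhsr.
(* At 0 the difference quotient of [pos_sqr] is the positive part itself, which is continuous. *)
- apply/is_derive1_caratheodory; exists (fun v => Num.max v 0); split.
  + move=> v; rewrite (@pos_sqr_eq0 0)// !subr0 /pos_sqr.
    by have [v0|v0] := leP v 0; rewrite ?expr0n ?mul0r ?expr2.
  + apply: cvg_trans; last first.
      apply: (@continuous_max _ _ id (cst 0)); first exact: cvg_id.
      exact: cvg_cst.
    by [].
  + by rewrite maxxx mulr0.
Unshelve. all: by end_near. Qed.

Lemma continuous_pos_sqr' : continuous (fun u : R => 2 * Num.max u 0).
Proof.
move=> u; apply: cvgM; first exact: cvg_cst.
apply: (@continuous_max _ _ id (cst 0)); [exact: cvg_id|exact: cvg_cst].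
Qed.

Definition C1_pair (e e' : R -> R) : Prop :=
  (forall u : R, is_derive u (1 : R) e (e' u)) /\ continuous e'.

Lemma C1_pair_continuous e e' : C1_pair e e' -> continuous e.
Proof.
move=> [de _] u; apply: differentiable_continuous; apply/derivable1_diffP.
by case: (de u).
Qed.

Lemma C1_pair_pos_sqr_affine (b c : R) :
  C1_pair (fun u => pos_sqr (b + c * u))
          (fun u => 2 * Num.max (b + c * u) 0 * c).
Proof.
have caff : continuous (fun u : R => b + c * u).
  move=> u; apply: cvgD; first exact: cvg_cst.
  by apply: cvgM; [exact: cvg_cst|exact: cvg_id].
split=> u.
- have daff : is_derive u (1 : R) (fun u : R => b + c * u) c.
    apply/is_derive1_caratheodory; exists (fun=> c); split=> //.
    + by move=> v; ring.
    + exact: cvg_cst.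
  exact: (@is_derive1_comp _ pos_sqr (fun u : R => b + c * u) u _ _
    (is_derive_pos_sqr _) daff).
- apply: cvgM; last exact: cvg_cst.
  apply: (@continuous_comp _ _ _ (fun u : R => b + c * u)
    (fun u : R => 2 * Num.max u 0)); first exact: caff.
  exact: continuous_pos_sqr'.
Qed.

(* A C^1 approximation, increasing in [n], of the indicator of [0 < u] that
   vanishes for [u <= 0]. *)
Definition eta (n : nat) (u : R) : R := 1 - (1 + pos_sqr (n%:R * u))^-1.

Lemma eta_den_gt0 (n : nat) (u : R) : 0 < 1 + pos_sqr (n%:R * u).
Proof. by rewrite ltr_wpDr ?pos_sqr_ge0. Qed.

Lemma eta_ge0 n u : 0 <= eta n u.
Proof.
rewrite /eta subr_ge0 invf_le1 ?eta_den_gt0//.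
by rewrite lerDl pos_sqr_ge0.
Qed.

Lemma eta_le1 n u : eta n u <= 1.
Proof. by rewrite /eta lerBlDr lerDl invr_ge0 ltW ?eta_den_gt0. Qed.

Lemma eta_le0 n u : u <= 0 -> eta n u = 0.
Proof.
by move=> u0; rewrite /eta pos_sqr_eq0 ?addr0 ?invr1 ?subrr// mulr_ge0_le0.
Qed.

Lemma eta_homo u : 0 <= u -> {homo eta^~ u : m n / (m <= n)%N >-> m <= n}.
Proof.
move=> u0 m n mn; rewrite /eta lerD2l lerN2 lef_pV2 ?posrE ?eta_den_gt0//.
by rewrite lerD2l pos_sqr_le// ler_wpM2r// ler_nat.
Qed.

Lemma cvg_eta u : 0 < u -> eta^~ u @ \oo --> (1 : R).
Proof.
move=> u0; rewrite -[X in _ --> X]subr0; apply: cvgB; first exact: cvg_cst.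
apply/gtr0_cvgV0; first by near=> n; exact: eta_den_gt0.
rewrite [X in X @ _ --> _](_ : _ = fun n : nat => 1 + (n%:R * u) ^+ 2); last first.
  by apply/funext => n; rewrite pos_sqrE// mulr_ge0// ltW.
apply/cvgryPge => A; near=> n.
have nA : A / u <= n%:R by near: n; exact: nbhs_infty_ger.
have n1 : 1 / u <= n%:R by near: n; exact: nbhs_infty_ger.
rewrite ler_pdivrMr// in nA; rewrite ler_pdivrMr// in n1.
nra.
Unshelve. all: by end_near. Qed.

(** With x and y the positive parts of n u and n v, the difference is (x - y) (x + y) / ((1 + x^2)
    (1 + y^2)), and 2 x <= 1 + x^2 makes the last factor at most 1. The bound serves to move the
    profile from time t to a nearby time s when the restricted path is shown to be cadlag. *)
Lemma eta_lip n u v : `|eta n u - eta n v| <= n%:R * `|u - v|.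
Proof.
have -> : n%:R * `|u - v| = `|n%:R * u - n%:R * v|.
  by rewrite -mulrBr normrM ger0_norm.
rewrite /eta /pos_sqr; set a := n%:R * u; set b := n%:R * v.
have mab : `|Num.max a 0 - Num.max b 0| <= `|a - b|.
  case: (leP a 0) (leP b 0) => [a0|a0] [b0|b0].
  - by rewrite subrr normr0.
  - by rewrite sub0r normrN gtr0_norm// ler0_norm; lra.
  - by rewrite subr0 gtr0_norm// ger0_norm; lra.
  - by [].
apply: le_trans mab.
have : 0 <= Num.max a 0 by rewrite le_max lexx orbT.
have : 0 <= Num.max b 0 by rewrite le_max lexx orbT.
move: (Num.max a 0) (Num.max b 0) => x y y0 x0.
have x2 : 0 < 1 + x ^+ 2 by rewrite ltr_wpDr ?sqr_ge0.
have y2 : 0 < 1 + y ^+ 2 by rewrite ltr_wpDr ?sqr_ge0.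
have -> : 1 - (1 + x ^+ 2)^-1 - (1 - (1 + y ^+ 2)^-1) =
    (x - y) * ((x + y) / ((1 + x ^+ 2) * (1 + y ^+ 2))).
  by field; rewrite !gt_eqF.
rewrite normrM ler_piMr// ger0_norm; last first.
  by rewrite divr_ge0 ?addr_ge0// ltW ?mulr_gt0.
rewrite ler_pdivrMr ?mulr_gt0// mul1r.
have := sqr_ge0 (x - 1); have := sqr_ge0 (y - 1).
have := mulr_ge0 (sqr_ge0 x) (sqr_ge0 y).
have -> : (1 + x ^+ 2) * (1 + y ^+ 2) = 1 + x ^+ 2 + y ^+ 2 + x ^+ 2 * y ^+ 2.
  by ring.
move=> h1 h2 h3; have e1 : x ^+ 2 = 2 * x - 1 + (x - 1) ^+ 2 by ring.
have e2 : y ^+ 2 = 2 * y - 1 + (y - 1) ^+ 2 by ring.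
have e3 := sqr_ge0 x; have e4 := sqr_ge0 y; lra.
Qed.

Definition eta' (n : nat) (u : R) : R :=
  (1 + pos_sqr (n%:R * u)) ^- 2 * (2 * Num.max (n%:R * u) 0 * n%:R).

Lemma C1_pair_eta n : C1_pair (eta n) (eta' n).
Proof.
have := C1_pair_pos_sqr_affine 0 n%:R.
under eq_fun do rewrite add0r.
under [X in C1_pair _ X]eq_fun do rewrite add0r.
move=> Cn; have [dn cn] := Cn; have c0 := C1_pair_continuous Cn; split=> u.
- have h1 : is_derive u (1 : R) (fun u : R => 1 + pos_sqr (n%:R * u))
      (2 * Num.max (n%:R * u) 0 * n%:R).
    by rewrite -[X in is_derive _ _ _ X]add0r; apply: is_deriveD.
  have n0 : 1 + pos_sqr (n%:R * u) != 0 by rewrite gt_eqF ?eta_den_gt0.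
  have h2 := @is_deriveV _ (fun u : R => 1 + pos_sqr (n%:R * u)) _ _ _ n0 h1.
  have -> : eta' n u = 0 - (- (1 + pos_sqr (n%:R * u)) ^- 2 *:
      (2 * Num.max (n%:R * u) 0 * n%:R : R)).
    by rewrite /eta' sub0r scaleNr opprK.
  exact: is_deriveB.
- apply: cvgM; last exact: cn.
  apply: cvgV; first by rewrite expf_eq0/= gt_eqF// eta_den_gt0.
  have cF : {for u, continuous (fun x : R => 1 + pos_sqr (n%:R * x))}.
    by apply: cvgD; [exact: cvg_cst|exact: c0].
  exact: (cvgM cF cF).
Qed.

(** Only u >= 0 matters, so a decreasing function can replace a bump: its derivative is never
    positive, which gives the transport of the cutoff a sign. *)
Definition cutoff (k : nat) (u : R) : R := pos_sqr (1 + - k.+1%:R^-1 * u).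

Definition cutoff' (k : nat) (u : R) : R :=
  2 * Num.max (1 + - k.+1%:R^-1 * u) 0 * - k.+1%:R^-1.

Lemma C1_pair_cutoff k : C1_pair (cutoff k) (cutoff' k).
Proof. exact: C1_pair_pos_sqr_affine. Qed.

Lemma cutoff_ge0 k u : 0 <= cutoff k u.
Proof. exact: pos_sqr_ge0. Qed.

Lemma cutoff_le1 k u : 0 <= u -> cutoff k u <= 1.
Proof.
move=> u0; rewrite -[leRHS](expr1n _ 2) -pos_sqrE// pos_sqr_le//.
by rewrite gerDl mulNr oppr_le0 mulr_ge0.
Qed.

Lemma cutoff'_le0 k u : cutoff' k u <= 0.
Proof.
by rewrite /cutoff' mulr_ge0_le0 ?oppr_le0 ?invr_ge0// mulr_ge0// le_max lexx orbT.
Qed.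

Lemma cutoff_eq0 k u : k.+1%:R <= u -> cutoff k u = 0.
Proof.
move=> ku; rewrite /cutoff pos_sqr_eq0// mulNr subr_le0.
by rewrite mulrC ler_pdivlMr ?mul1r ?ltr0n.
Qed.

Lemma cvg_cutoff u : cutoff^~ u @ \oo --> (1 : R).
Proof.
rewrite -[X in _ --> X](expr1n _ 2) -(@pos_sqrE 1)//.
apply: (@continuous_cvg _ _ _ _ _ _ (fun v : R => pos_sqr v)).
  have := C1_pair_continuous (C1_pair_pos_sqr_affine 0 1).
  by under eq_fun do rewrite add0r mul1r; move=> /(_ 1).
rewrite -[X in _ --> X]addr0; apply: cvgD; first exact: cvg_cst.
rewrite -(mul0r u); apply: cvgM; last exact: cvg_cst.
rewrite -oppr0; apply: cvgN; exact: cvg_harmonic.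
Qed.

End plateau_functions.

(** * Products of test functions with functions of s - y, and compactly supported cutoffs *)

Section test_function_calculus.
Context {R : realType}.
Implicit Types (phi : R * (R * R) -> R) (e : R -> R).

Lemma octantP (s x y : R) :
  octant (s, (x, y)) <-> [/\ 0 <= s, 0 <= x & 0 <= y].
Proof.
rewrite /octant/quadrant/=; split; last by move=> [? ? ?]; rewrite !RplusP.
by move=> [/RplusP ? [/RplusP ? /RplusP ?]].
Qed.

Lemma quadrantP (z : R * R) : quadrant z <-> 0 <= z.1 /\ 0 <= z.2.
Proof. by rewrite /quadrant/=; split => -[/RplusP ? /RplusP ?]. Qed.

Definition partials phi (s x y a b c : R) : Prop :=
  [/\ is_dplus (fun u => phi (u, (x, y))) s a,
      is_dplus (fun u => phi (s, (u, y))) x b &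
      is_dplus (fun u => phi (s, (x, u))) y c].

Lemma partialsE phi s x y a b c : octant (s, (x, y)) ->
  partials phi s x y a b c ->
  [/\ phi_t phi (s, (x, y)) = a, phi_x phi (s, (x, y)) = b &
      phi_y phi (s, (x, y)) = c].
Proof.
move=> /octantP[s0 x0 y0] [da db dc].
split; rewrite /phi_t /phi_x /phi_y /pdx /pdy/=.
- exact: is_dplus_derive.
- exact: is_dplus_derive.
- exact: is_dplus_derive.
Qed.

(** Continuity is checked on explicit formulas and transferred to [phi_t], [phi_x] and [phi_y],
    which agree with them on the octant. *)
Lemma C1c_octantI phi (pt px py : R * (R * R) -> R) :
  {within octant, continuous phi} ->
  (forall s x y, octant (s, (x, y)) -> partials phi s x y
    (pt (s, (x, y))) (px (s, (x, y))) (py (s, (x, y)))) ->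
  {within octant, continuous pt} ->
  {within octant, continuous px} ->
  {within octant, continuous py} ->
  compact (closure [set p | octant p /\ phi p != 0]) ->
  C1c_octant phi.
Proof.
move=> cphi dphi ct cx cy cpt; split => //.
- by move=> s x y /dphi[ds dx dy]; split; apply: is_dplus_derivable; eassumption.
- split.
  + apply: subspace_eq_continuous ct => -[s [x y]] /set_mem o.
    by have [h _ _] := partialsE o (dphi _ _ _ o); exact: esym.
  + apply: subspace_eq_continuous cx => -[s [x y]] /set_mem o.
    by have [_ h _] := partialsE o (dphi _ _ _ o); exact: esym.
  + apply: subspace_eq_continuous cy => -[s [x y]] /set_mem o.
    by have [_ _ h] := partialsE o (dphi _ _ _ o); exact: esym.
Qed.

Lemma C1c_partials phi s x y : C1c_octant phi -> octant (s, (x, y)) ->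
  partials phi s x y (phi_t phi (s, (x, y))) (phi_x phi (s, (x, y)))
    (phi_y phi (s, (x, y))).
Proof.
move=> [_ d _ _] /d[ds dx dy]; split; exact: derivable_plus_is_dplus.
Qed.

Lemma within_continuousM (T : topologicalType) (A : set T) (f g : T -> R) :
  {within A, continuous f} -> {within A, continuous g} ->
  {within A, continuous (fun z => f z * g z)}.
Proof.
move=> /subspace_continuousP cf /subspace_continuousP cg.
by apply/subspace_continuousP => z Az; apply: cvgM; [exact: cf|exact: cg].
Qed.

Lemma within_continuousD (T : topologicalType) (A : set T) (f g : T -> R) :
  {within A, continuous f} -> {within A, continuous g} ->
  {within A, continuous (fun z => f z + g z)}.
Proof.
move=> /subspace_continuousP cf /subspace_continuousP cg.
by apply/subspace_continuousP => z Az; apply: cvgD; [exact: cf|exact: cg].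
Qed.

(** Time and y both grow at unit rate, so s - y is constant along characteristics; it is the time at
    which mass found at height y at time s has, or would have, entered at y = 0. *)
Definition age (p : R * (R * R)) : R := p.1 - p.2.2.

Lemma continuous_age : continuous age.
Proof.
move=> p; apply: cvgB; first exact: cvg_fst.
apply: cvg_comp; first exact: cvg_snd.
exact: cvg_snd.
Qed.

Lemma partials_mul_age phi e e' s x y a b c : C1_pair e e' ->
  partials phi s x y a b c ->
  let d := e (s - y) in let d' := e' (s - y) in
  partials (fun p => phi p * e (age p)) s x y
    (a * d + phi (s, (x, y)) * d') (b * d) (c * d - phi (s, (x, y)) * d').
Proof.
move=> [de _] [ds dx dy] d d'; rewrite /age; split => /=.
- apply: is_dplusM => //.
  have h : is_dplus (fun u => - y + 1 * u) s 1 by exact: is_dplus_affine.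
  rewrite /d' -(mulr1 (e' _)); apply: (@is_dplus_comp _ (fun u => u - y)) => //.
  by move: h; under eq_fun do rewrite mul1r addrC.
- have h : is_dplus (fun=> e (s - y)) x 0.
    have := @is_dplus_affine R (e (s - y)) 0 x.
    by under eq_fun do rewrite mul0r addr0.
  by have := is_dplusM dx h; rewrite mulr0 addr0.
- rewrite -mulrN; apply: is_dplusM => //.
  have h : is_dplus (fun u => s + -1 * u) y (-1) by exact: is_dplus_affine.
  rewrite /d' -mulrN1; apply: (@is_dplus_comp _ (fun u => s - u)) => //.
  by move: h; under eq_fun do rewrite mulN1r.
Qed.

Lemma C1c_mul_age phi e e' : C1c_octant phi -> C1_pair e e' ->
  C1c_octant (fun p => phi p * e (age p)).
Proof.
move=> Cphi Ce; have [cphi _ [ct cx cy] cpt] := Cphi; have [_ ce'] := Ce.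
have ce := C1_pair_continuous Ce.
have cea : {within octant, continuous (e \o age)}.
  apply: continuous_subspaceT => p.
  by apply: continuous_comp; [exact: continuous_age|exact: ce].
have cea' : {within octant, continuous (e' \o age)}.
  apply: continuous_subspaceT => p.
  by apply: continuous_comp; [exact: continuous_age|exact: ce'].
have cN : {within octant, continuous (fun p => - e' (age p))}.
  apply/subspace_continuousP => p op; apply: cvgN.
  by move/subspace_continuousP : cea'; exact.
apply: (@C1c_octantI _
  (fun p => phi_t phi p * e (age p) + phi p * e' (age p))
  (fun p => phi_x phi p * e (age p))
  (fun p => phi_y phi p * e (age p) + phi p * - e' (age p))).
- exact: (within_continuousM cphi cea).
- move=> s x y o; have := partials_mul_age Ce (C1c_partials Cphi o).
  by rewrite /age/= mulrN.
- exact: (within_continuousD (within_continuousM ct cea)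
    (within_continuousM cphi cea')).
- exact: (within_continuousM cx cea).
- exact: (within_continuousD (within_continuousM cy cea)
    (within_continuousM cphi cN)).
- apply: (subclosed_compact _ cpt); first exact: closed_closure.
  apply: closure_subset => p [op]; rewrite mulf_eq0 negb_or => /andP[h _].
  by split.
Qed.

Lemma partialsE_mul_age phi e e' s x y : C1c_octant phi -> C1_pair e e' ->
  octant (s, (x, y)) -> let psi := fun p => phi p * e (age p) in
  [/\ phi_t psi (s, (x, y)) =
        phi_t phi (s, (x, y)) * e (s - y) + phi (s, (x, y)) * e' (s - y),
      phi_x psi (s, (x, y)) = phi_x phi (s, (x, y)) * e (s - y) &
      phi_y psi (s, (x, y)) =
        phi_y phi (s, (x, y)) * e (s - y) - phi (s, (x, y)) * e' (s - y)].
Proof.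
move=> Cphi Ce o psi.
exact: (partialsE o (partials_mul_age Ce (C1c_partials Cphi o))).
Qed.

(** The terms with [e'] from the time and y derivatives cancel, and the factor does not depend on x.
    No derivative of the profile survives, so the profile may be sharpened to an indicator without
    any blow-up. *)
Lemma transport_mul_age (m : MFplus R) phi e e' s z :
  C1c_octant phi -> C1_pair e e' -> octant (s, z) ->
  transport m (fun p => phi p * e (age p)) s z = transport m phi s z * e (s - z.2).
Proof.
case: z => x y Cphi Ce o; rewrite /transport.
by have [-> -> ->] := partialsE_mul_age Cphi Ce o => /=; ring.
Qed.

Definition box_cutoff (k : nat) (p : R * (R * R)) : R :=
  cutoff k p.1 * (cutoff k p.2.1 * cutoff k p.2.2).

Lemma box_cutoff_ge0 k p : 0 <= box_cutoff k p.
Proof.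
rewrite /box_cutoff; apply: mulr_ge0; first exact: cutoff_ge0.
by apply: mulr_ge0; exact: cutoff_ge0.
Qed.

Lemma box_cutoff_le1 k p : octant p -> box_cutoff k p <= 1.
Proof.
case: p => s [x y] /octantP[s0 x0 y0]; rewrite /box_cutoff/=.
have c0 (u : R) := cutoff_ge0 k u.
have c1 (u : R) : 0 <= u -> cutoff k u <= 1 by exact: cutoff_le1.
apply: mulr_ile1 => //; first exact: mulr_ge0.
  exact: c1.
by apply: mulr_ile1 => //; exact: c1.
Qed.

Lemma cvg_box_cutoff p : box_cutoff^~ p @ \oo --> (1 : R).
Proof.
rewrite -[X in _ --> X](mul1r (1 : R)); apply: cvgM; first exact: cvg_cutoff.
by rewrite -[X in _ --> X](mul1r (1 : R)); apply: cvgM; exact: cvg_cutoff.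
Qed.

Lemma C1_pair_dplus e (e' : R -> R) (u : R) :
  C1_pair e e' -> is_dplus e u (e' u).
Proof.
move=> [de _]; have := @is_dplus_affine R 0 1 u.
under eq_fun do rewrite add0r mul1r.
by move=> h; rewrite -(mulr1 (e' u)); exact: (is_dplus_comp h (de u)).
Qed.

Lemma partials_box_cutoff k s x y : partials (box_cutoff k) s x y
  (cutoff' k s * (cutoff k x * cutoff k y))
  (cutoff k s * (cutoff' k x * cutoff k y))
  (cutoff k s * (cutoff k x * cutoff' k y)).
Proof.
have cst (c u : R) : is_dplus (fun=> c) u 0.
  have := @is_dplus_affine R c 0 u.
  by under eq_fun do rewrite mul0r addr0.
have d (u : R) : is_dplus (cutoff k) u (cutoff' k u).
  by apply: C1_pair_dplus; exact: C1_pair_cutoff.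
split; rewrite /box_cutoff/=.
- have := is_dplusM (d s) (cst (cutoff k x * cutoff k y) s).
  by rewrite mulr0 addr0.
- have := is_dplusM (cst (cutoff k s) x) (is_dplusM (d x) (cst (cutoff k y) x)).
  by rewrite mul0r add0r mulr0 addr0.
- have := is_dplusM (cst (cutoff k s) y) (is_dplusM (cst (cutoff k x) y) (d y)).
  by rewrite !mul0r !add0r.
Qed.

Lemma C1c_box_cutoff k : C1c_octant (box_cutoff k).
Proof.
have [_ c'] := @C1_pair_cutoff R k; have c := C1_pair_continuous (@C1_pair_cutoff R k).
have prod (f g h : R -> R) : continuous f -> continuous g -> continuous h ->
    {within octant, continuous (fun p : R * (R * R) => f p.1 * (g p.2.1 * h p.2.2))}.
  move=> cf cg ch; apply: continuous_subspaceT => p; apply: cvgM.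
    by apply: (@continuous_comp _ _ _ fst f); [exact: cvg_fst|exact: cf].
  apply: cvgM.
    apply: (@continuous_comp _ _ _ (fst \o snd) g); last exact: cg.
    by apply: continuous_comp; [exact: cvg_snd|exact: cvg_fst].
  apply: (@continuous_comp _ _ _ (snd \o snd) h); last exact: ch.
  by apply: continuous_comp; [exact: cvg_snd|exact: cvg_snd].
apply: (@C1c_octantI _
  (fun p => cutoff' k p.1 * (cutoff k p.2.1 * cutoff k p.2.2))
  (fun p => cutoff k p.1 * (cutoff' k p.2.1 * cutoff k p.2.2))
  (fun p => cutoff k p.1 * (cutoff k p.2.1 * cutoff' k p.2.2))).
- exact: prod.
- by move=> s x y _; exact: partials_box_cutoff.
- exact: prod.
- exact: prod.
- exact: prod.
- pose I := `[0, k.+1%:R : R]%classic.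
  have cB : compact (I `*` (I `*` I)).
    by apply: compact_setX; [|apply: compact_setX]; exact: segment_compact.
  apply: (subclosed_compact _ cB); first exact: closed_closure.
  have clB : closed (I `*` (I `*` I)).
    by apply: compact_closed => //; exact: hausdorff_prod.
  rewrite [X in _ `<=` X](closure_id _).1//; apply: closure_subset.
  move=> [s [x y]] [/octantP[s0 x0 y0]].
  move=> h; have hs : cutoff k s != 0.
    by apply: contraNneq h => h0; rewrite /box_cutoff/= h0 mul0r.
  have hx : cutoff k x != 0.
    by apply: contraNneq h => h0; rewrite /box_cutoff/= h0 mul0r mulr0.
  have hy : cutoff k y != 0.
    by apply: contraNneq h => h0; rewrite /box_cutoff/= h0 !mulr0.
  have le (u : R) : cutoff k u != 0 -> u <= k.+1%:R.
    by apply: contraNT; rewrite -ltNge => /ltW/cutoff_eq0 ->.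
  rewrite /I/= !in_itv/= s0 x0 y0/=; split; first exact: le.
  by split; exact: le.
Qed.

(** The velocities 1, [rbar] and 1 are nonnegative, and the cutoff is nonincreasing in each
    coordinate. *)
Lemma transport_box_cutoff_le0 (m : MFplus R) k s z : octant (s, z) ->
  transport m (box_cutoff k) s z <= 0.
Proof.
case: z => x y o; rewrite /transport.
have [-> -> ->] := partialsE o (partials_box_cutoff k s x y).
have c0 (u : R) := cutoff_ge0 k u; have c'0 (u : R) := cutoff'_le0 k u.
have nx : cutoff k s * (cutoff' k x * cutoff k y) <= 0.
  by rewrite mulr_ge0_le0// mulr_le0_ge0.
rewrite -[leRHS]addr0 lerD//; last by rewrite mulr_ge0_le0// mulr_ge0_le0.
rewrite -[leRHS]addr0 lerD//; first by rewrite mulr_le0_ge0// mulr_ge0.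
by rewrite mulr_ge0_le0// /rbar ler0n.
Qed.

End test_function_calculus.

(** * Measurability from one-sided or relative continuity, by rounding to a grid *)

Section measurability_by_discretization.
Context {R : realType}.

Lemma measurable_fun_factor_count d d' (X : measurableType d)
    (Y : measurableType d') (I : countType) (idx : X -> I) (h : I -> Y) :
  (forall i, measurable (idx @^-1` [set i])) ->
  measurable_fun setT (h \o idx).
Proof.
move=> midx _ B mB; rewrite setTI.
rewrite (_ : _ @^-1` _ = \bigcup_(i : I)
    (if `[< B (h i) >] then idx @^-1` [set i] else set0)); last first.
  apply/seteqP; split => [x /= Bx|x [i _]].
    by exists (idx x) => //; case: asboolP.
  by case: asboolP => // Bi /= ->.
apply: countable_bigcupT_measurable => [|i]; first exact: countableP.
by case: ifPn.
Qed.

Definition grid_index (n : nat) (u : R) : int := Num.floor (n.+1%:R * u).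

Lemma measurable_grid_index n i :
  measurable (@grid_index n @^-1` [set i] : set (measurableTypeR R)).
Proof.
rewrite (_ : _ @^-1` _ = `[i%:~R / n.+1%:R, (i + 1)%:~R / n.+1%:R[%classic).
  exact: measurable_itv.
apply/seteqP; split => u /=; rewrite in_itv/= ler_pdivrMr// ltr_pdivlMr// mulrC.
  by move=> <-; exact: floor_itv.
exact: floor_def.
Qed.

Definition grid_point (n : nat) (i : int) : R := i%:~R / n.+1%:R.

Lemma grid_point_ge0 n u : 0 <= u -> 0 <= grid_point n (grid_index n u).
Proof. by move=> u0; rewrite divr_ge0// ler0z floor_ge0 mulr_ge0. Qed.

Lemma grid_point_itv n u :
  grid_point n (grid_index n u) <= u < grid_point n (grid_index n u + 1).
Proof. by rewrite ler_pdivrMr// ltr_pdivlMr// mulrC; exact: floor_itv. Qed.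

Lemma grid_pointD1 n i : grid_point n (i + 1) = grid_point n i + n.+1%:R^-1.
Proof. by rewrite /grid_point intrD mulrDl mul1r. Qed.

Lemma cvg_grid_point (u : R) : (fun n => grid_point n (grid_index n u)) @ \oo --> u.
Proof.
apply: (@squeeze_cvgr _ _ _ _ (fun n => u - n.+1%:R^-1) (fun=> u)).
- apply: nearW => n; have /andP[h1 h2] := grid_point_itv n u.
  by rewrite h1 andbT lerBlDr ltW// -grid_pointD1.
- by rewrite -[X in _ --> X]subr0; apply: cvgB; [exact: cvg_cst|exact: cvg_harmonic].
- exact: cvg_cst.
Qed.

Lemma cvg_grid_point_right (u : R) :
  (fun n => grid_point n (grid_index n u + 1)) @ \oo --> u^'+.
Proof.
have cu : (fun n => grid_point n (grid_index n u + 1)) @ \oo --> u.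
  under eq_fun do rewrite grid_pointD1.
  have h := cvgD (@cvg_grid_point u) (@cvg_harmonic R).
  by rewrite addr0 in h; exact: h.
move=> A nA; have h := cu _ nA; apply: (@filterS _ \oo _ _ _ _ h) => n; apply.
by have /andP[] := grid_point_itv n u.
Qed.

Lemma right_cvg_measurable (F : R -> \bar R) :
  (forall t, F @ t^'+ --> F t) ->
  measurable_fun (setT : set (measurableTypeR R)) F.
Proof.
move=> cF; apply: (@emeasurable_fun_cvg _ _ _ _
  (fun n => (fun i => F (grid_point n (i + 1))) \o grid_index n)).
- by move=> n; apply: measurable_fun_factor_count; exact: measurable_grid_index.
- by move=> t _; exact: (cvg_comp (fun n => grid_point n (grid_index n t + 1))
    F (@cvg_grid_point_right t) (cF t)).
Qed.

Definition timespace := (measurableTypeR R * plane R)%type.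

Lemma measurable_Rplus : measurable (Rplus : set (measurableTypeR R)).
Proof. exact: measurable_itv. Qed.

Lemma measurable_quadrant : measurable (quadrant : set (plane R)).
Proof. by apply: measurableX; exact: measurable_Rplus. Qed.

Lemma measurable_octant : measurable (octant : set timespace).
Proof. by apply: measurableX; [exact: measurable_Rplus|exact: measurable_quadrant]. Qed.

(* Rounding down to a grid keeps points in the octant, so continuity within the
   octant makes [F] the limit of the functions [F] of the rounded point. *)
Lemma octant_continuous_measurable (F : R * (R * R) -> R) :
  {within octant, continuous F} ->
  measurable_fun (octant : set timespace) (F : timespace -> R).
Proof.
move=> /subspace_continuousP cF.
pose idx n (p : timespace) :=
  (grid_index n p.1, (grid_index n p.2.1, grid_index n p.2.2)).
pose pt n (i : int * (int * int)) : timespace :=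
  (grid_point n i.1, (grid_point n i.2.1, grid_point n i.2.2)).
apply: (@measurable_fun_cvg _ _ _ _ (fun n => (fun i => F (pt n i)) \o idx n)).
- move=> n; apply: measurable_funTS; apply: measurable_fun_factor_count => -[i [j k]].
  rewrite (_ : _ @^-1` _ = (grid_index n @^-1` [set i]) `*`
     ((grid_index n @^-1` [set j]) `*` (grid_index n @^-1` [set k]))); last first.
    apply/seteqP; split => [[s [x y]]/= [-> -> ->]//|[s [x y]]/= [h1 [h2 h3]]].
    by rewrite /idx/= h1 h2 h3.
  apply: measurableX; first exact: measurable_grid_index.
  by apply: measurableX; exact: measurable_grid_index.
- move=> [s [x y]] o; apply: (cvg_comp (fun n => pt n (idx n (s, (x, y)))) F) (cF _ o).
  have cpt : (fun n => pt n (idx n (s, (x, y)))) @ \oo --> ((s, (x, y)) : R * (R * R)).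
    exact: (cvg_pair (@cvg_grid_point s)
      (cvg_pair (@cvg_grid_point x) (@cvg_grid_point y))).
  move=> A nA; have h := cpt _ nA; apply: (@filterS _ \oo _ _ _ _ h) => n; apply.
  by move/octantP : o => [s0 x0 y0]; apply/octantP; split; exact: grid_point_ge0.
Qed.

(** The function is extended to the octant as constant in time, and the result there is read back on
    the slice at time 0. *)
Lemma quadrant_continuous_measurable (f : R * R -> R) :
  {within quadrant, continuous f} ->
  measurable_fun (quadrant : set (plane R)) (f : plane R -> R).
Proof.
move=> /subspace_continuousP cf.
have : measurable_fun (octant : set timespace) (fun p : timespace => f p.2).
  apply: octant_continuous_measurable; apply/subspace_continuousP => -[s z] [s0 qz].
  apply: (cvg_comp snd f) (cf _ qz) => A.
  rewrite /within/= => nA.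
  have hs : (@snd R (R * R)) @ nbhs (s, z) --> nbhs z by exact: cvg_snd.
  have h := hs _ nA.
  by apply: (@filterS _ (nbhs (s, z)) _ _ _ _ h) => p hp [_ q]; exact: hp.
move=> mf.
apply: (measurable_comp (g := fun z : plane R => ((0 : measurableTypeR R), z))
  measurable_octant _ mf).
- by move=> _ [z qz <-]; split => //; apply/RplusP.
- by apply: measurable_funTS; apply: measurable_fun_pair.
Qed.

End measurability_by_discretization.
Arguments timespace : clear implicits.

(** * Integrals against finite measures carried by the quadrant *)

Section brackets.
Context {R : realType}.
Implicit Types (m : MFplus R) (f : R * R -> R) (A : set (plane R)).

Local Notation Q := (quadrant : set (plane R)).

Lemma mf_setI_quadrant m A : measurable A -> m (A `&` Q) = m A.
Proof.
move=> mA; rewrite [in RHS](_ : A = (A `&` Q) `|` (A `&` ~` Q)); last first.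
  by rewrite -setIUr setUCr setIT.
have mQ := @measurable_quadrant R.
rewrite measureU; [|exact: measurableI
  |by apply: measurableI => //; exact: measurableC|]; last first.
  by rewrite setIACA setICr setI0.
rewrite [X in (_ + X)%E](_ : _ = 0%E) ?adde0//.
apply/eqP; rewrite eq_le measure_ge0 andbT -(mf_carried m).
apply: le_measure; rewrite ?inE.
- by apply: measurableI => //; exact: measurableC.
- exact: measurableC.
- exact: subIsetr.
Qed.

Lemma mf_fin_num m A : measurable A -> m A \is a fin_num.
Proof. by move=> mA; exact: fin_num_measure. Qed.

Lemma mf_lty m A : measurable A -> (m A < +oo)%E.
Proof. by move=> mA; rewrite ltey_eq mf_fin_num. Qed.

Lemma bracket_eq m f f' : (forall z, Q z -> f z = f' z) ->
  bracket f m = bracket f' m.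
Proof. by move=> ff; apply: eq_integral => z /set_mem qz; rewrite ff. Qed.

Lemma bracket_ge0 m f : (forall z, Q z -> 0 <= f z) -> (0 <= bracket f m)%E.
Proof. by move=> f0; apply: integral_ge0 => z qz; rewrite lee_fin f0. Qed.

Lemma bracket_cst m (c : R) : bracket (fun=> c) m = (c%:E * m setT)%E.
Proof.
rewrite /bracket integral_cst//; last exact: measurable_quadrant.
by rewrite -(mf_setI_quadrant m measurableT) setTI.
Qed.

Lemma bounded_bracket_integrable m f (C : R) :
  measurable_fun Q (f : plane R -> R) -> (forall z, Q z -> `|f z| <= C) ->
  m.-integrable Q (EFin \o f).
Proof.
move=> mf fC; apply: (@le_integrable _ _ _ _ _ (@measurable_quadrant R) _
  (EFin \o cst C)).
- exact/measurable_EFinP.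
- by move=> z qz /=; rewrite lee_fin (le_trans (fC _ qz))// ler_norm.
- by apply: finite_measure_integrable_cst; exact: measurable_quadrant.
Qed.

Lemma cvg_bracket m (f_ : nat -> R * R -> R) f (C : R) :
  (forall n, measurable_fun Q (f_ n : plane R -> R)) ->
  (forall n z, Q z -> `|f_ n z| <= C) ->
  (forall z, Q z -> f_ ^~ z @ \oo --> f z) ->
  (fun n => bracket (f_ n) m) @ \oo --> bracket f m.
Proof.
move=> mf fC cf; have mQ := @measurable_quadrant R.
have mlim : measurable_fun Q (f : plane R -> R).
  exact: (measurable_fun_cvg mf cf).
have [|||||_ _ //] := @dominated_convergence _ _ _ m _ mQ
  (fun n z => (f_ n z)%:E) (fun z => (f z)%:E) (fun=> C%:E).
- by move=> n; exact/measurable_EFinP.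
- exact/measurable_EFinP.
- apply/aeW => z qz; apply: cvg_EFin; last exact: cf.
  exact: nearW.
- exact: finite_measure_integrable_cst.
- by apply/aeW => z n qz; rewrite lee_fin; exact: fC.
Qed.

End brackets.

(** * A cadlag path of measures as a finite kernel, and dominated convergence in time and space *)

Section cadlag_kernel.
Context {R : realType}.
Variables (mu : R -> MFplus R) (T : R).
Hypotheses (mu_cadlag : cadlag mu) (T_ge0 : 0 <= T).

Local Notation Q := (quadrant : set (plane R)).

(* Freezing the path outside [0, T] makes it a finite kernel on all of [R]. *)
Definition clamp (s : R) : R := Num.max 0 (Num.min s T).

Lemma clamp_id s : 0 <= s <= T -> clamp s = s.
Proof. by move=> /andP[s0 sT]; rewrite /clamp min_l// max_r. Qed.

Lemma clamp_itv s : 0 <= clamp s <= T.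
Proof. by rewrite /clamp le_max lexx/= ge_max T_ge0 ge_min lexx orbT. Qed.

Lemma measurable_clamp_bracket f : {within quadrant, continuous f} ->
  [bounded f z | z in quadrant] ->
  measurable_fun setT (fun s : measurableTypeR R => bracket f (mu (clamp s))).
Proof.
move=> cf bf; apply: right_cvg_measurable => t.
(* Right continuity holds in three regimes: to the left of 0 and from T on the clamped path is
   locally constant on the right, and in between it is the given path. *)
have cstr (c : \bar R) (F : R -> \bar R) : (\forall s \near t^'+, F s = c) ->
    F @ t^'+ --> c.
  move=> h; have hc : (fun=> c) @ t^'+ --> c by exact: cvg_cst.
  apply: cvg_trans hc; apply: (@near_eq_cvg _ _ t^'+).
  by near=> s; apply/esym; near: s.
have [t0|t0] := ltP t 0.
  apply: cstr; near=> s; congr (bracket f (mu _)); rewrite /clamp.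
  have s0 : s <= 0 by apply: ltW; near: s; exact: nbhs_right_lt.
  have sT : s <= T by exact: le_trans T_ge0.
  have tT : t <= T by exact: le_trans (ltW t0) T_ge0.
  by rewrite !min_l// !max_l// ltW.
have [Tt|tT] := leP T t.
  apply: cstr; near=> s; congr (bracket f (mu _)); rewrite /clamp.
  rewrite !min_r//; apply: (le_trans Tt).
  by apply: ltW; near: s; exact: nbhs_right_gt.
rewrite clamp_id ?t0 ?ltW//.
have := (mu_cadlag.1 t t0) f cf bf; apply: cvg_trans.
apply: (@near_eq_cvg _ _ t^'+).
near=> s; rewrite clamp_id//; apply/andP; split.
  by apply: (le_trans t0); apply: ltW; near: s; exact: nbhs_right_gt.
by apply: ltW; near: s; exact: nbhs_right_lt.
Unshelve. all: by end_near. Qed.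

(** Open corners are stable under intersection and generate the Borel sets, and their indicators are
    limits of products of two [eta] profiles, which are bounded and continuous. *)
Definition corner (a b : R) : set (plane R) := `]a, +oo[ `*` `]b, +oo[.

Lemma measurable_clamp_corner a b :
  measurable_fun setT (fun s : measurableTypeR R => mu (clamp s) (corner a b)).
Proof.
have mc : measurable (corner a b) by apply: measurableX; exact: measurable_itv.
pose f_ n (z : R * R) := eta n (z.1 - a) * eta n (z.2 - b).
have ce n := C1_pair_continuous (@C1_pair_eta R n).
have cf n : continuous (f_ n).
  move=> z; apply: cvgM.
    apply: (@continuous_comp _ _ _ (fun z => z.1 - a) (eta n)); last exact: ce.
    by apply: cvgB; [exact: cvg_fst|exact: cvg_cst].
  apply: (@continuous_comp _ _ _ (fun z => z.2 - b) (eta n)); last exact: ce.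
  by apply: cvgB; [exact: cvg_snd|exact: cvg_cst].
have f01 n z : `|f_ n z| <= 1.
  rewrite ger0_norm ?mulr_ge0 ?eta_ge0//.
  by apply: mulr_ile1; rewrite ?eta_ge0 ?eta_le1.
have cfQ n : {within quadrant, continuous (f_ n)} by exact: continuous_subspaceT.
apply: (@emeasurable_fun_cvg _ _ _ _
  (fun n (s : measurableTypeR R) => bracket (f_ n) (mu (clamp s)))).
  move=> n; apply: measurable_clamp_bracket => //.
  exists 1; split; first exact: num_real.
  by move=> M M1 z _ /=; rewrite (le_trans (f01 _ _))// ltW.
move=> s _.
have -> : mu (clamp s) (corner a b) = bracket \1_(corner a b) (mu (clamp s)).
  rewrite /bracket integral_indic//; last exact: measurable_quadrant.
  exact: esym (mf_setI_quadrant _ mc).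
apply: (@cvg_bracket _ _ _ _ 1) => [n|n z _|z _].
- exact: quadrant_continuous_measurable.
- exact: f01.
- rewrite /f_ indicE /corner.
  have [za|za] := ltP a z.1; have [zb|zb] := ltP b z.2.
  + rewrite mem_set/=; last by rewrite /= !in_itv/= za zb.
    rewrite -[X in _ --> X](mul1r (1 : R)).
    by apply: cvgM; apply: cvg_eta; rewrite subr_gt0.
  + rewrite memNset/=; last by rewrite /= !in_itv/= [b < _]ltNge zb => -[].
    under eq_fun do rewrite (@eta_le0 _ _ (z.2 - b)) ?subr_le0// mulr0.
    exact: cvg_cst.
  + rewrite memNset/=; last by rewrite /= !in_itv/= [a < _]ltNge za => -[].
    under eq_fun do rewrite (@eta_le0 _ _ (z.1 - a)) ?subr_le0// mul0r.
    exact: cvg_cst.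
  + rewrite memNset/=; last by rewrite /= !in_itv/= [b < _]ltNge zb => -[].
    under eq_fun do rewrite (@eta_le0 _ _ (z.2 - b)) ?subr_le0// mulr0.
    exact: cvg_cst.
Qed.

Definition corners : set (set (plane R)) := [set A | exists a b, A = corner a b].

(** An open half plane is a countable union of corners whose other bound is -n. Both coordinates are
    thus measurable for the generated sigma-algebra, and so is the identity, which is their
    pairing. *)
Lemma measurable_plane_corners : @measurable _ (plane R) = <<s corners >>.
Proof.
apply/seteqP; split; last first.
  apply: smallest_sub; first exact: sigma_algebra_measurable.
  by move=> _ [a [b ->]]; apply: measurableX; exact: measurable_itv.
pose G := g_sigma_algebraType corners.
have mc a b : (measurable : set (set G)) (corner a b).
  by apply: sub_sigma_algebra; exists a, b.
have exnat (x : R) : exists n : nat, - n%:R < x.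
  have := archi_boundP (normr_ge0 x); set n := Num.bound _ => xn; exists n.
  by rewrite ltrNl (le_lt_trans (ler_norm _))// normrN.
have mfst : measurable_fun (setT : set G) (fst : G -> measurableTypeR R).
  apply: (measurability _ (RGenOInfty.measurableE R)).
  move=> _ [_ [a ->] <-]; rewrite setTI.
  rewrite (_ : _ @^-1` _ = \bigcup_n (corner a (- n%:R))).
    by apply: bigcup_measurable => n _; exact: mc.
  apply/seteqP; split => [[x y] /= xa|[x y] [n _] []//].
  by have [n yn] := exnat y; exists n => //; split => //=; rewrite in_itv/= yn.
have msnd : measurable_fun (setT : set G) (snd : G -> measurableTypeR R).
  apply: (measurability _ (RGenOInfty.measurableE R)).
  move=> _ [_ [a ->] <-]; rewrite setTI.
  rewrite (_ : _ @^-1` _ = \bigcup_n (corner (- n%:R) a)).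
    by apply: bigcup_measurable => n _; exact: mc.
  apply/seteqP; split => [[x y] /= xa|[x y] [n _] []//].
  by have [n yn] := exnat x; exists n => //; split => //=; rewrite in_itv/= yn.
have mid := measurable_fun_pair mfst msnd.
move=> A mA; have := mid measurableT A mA; rewrite setTI.
rewrite (_ : _ @^-1` _ = A)//.
by apply/seteqP; split => -[x y].
Qed.

Lemma measurable_clamp_set (A : set (plane R)) : measurable A ->
  measurable_fun setT (fun s : measurableTypeR R => mu (clamp s) A).
Proof.
have mT : measurable_fun setT (fun s : measurableTypeR R => mu (clamp s) setT).
  rewrite (_ : (fun _ => _) = fun s => bracket (fun=> 1) (mu (clamp s))).
    apply: measurable_clamp_bracket; first by move=> ?; exact: cvg_cst.
    exists 1; split; first exact: num_real.
    by move=> M M1 z _ /=; rewrite normr1 ltW.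
  by apply/funext => s; rewrite bracket_cst mul1e.
move=> mA; have := mA; rewrite measurable_plane_corners.
apply: (@dynkin_induction _ _ _ (fun A : set (plane R) =>
  measurable_fun setT (fun s : measurableTypeR R => mu (clamp s) A))).
- exact: measurable_plane_corners.
- move=> _ _ [a [b ->]] [c [d ->]]; exists (Num.max a c), (Num.max b d).
  apply/seteqP; split => -[x y]; rewrite /corner/= !in_itv/= !andbT !gt_max.
    by move=> [[-> ->] [-> ->]].
  by move=> [/andP[-> ->] /andP[-> ->]].
- exact: mT.
- by move=> _ [a [b ->]]; exact: measurable_clamp_corner.
- move=> S mS hS.
  rewrite (_ : (fun _ => _) = fun s => (mu (clamp s) setT - mu (clamp s) S)%E).
    exact: emeasurable_funB.
  apply/funext => s; rewrite -setTD measureD// ?setTI//.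
  exact: mf_lty.
- move=> F mF tF hF.
  rewrite (_ : (fun _ => _) = fun s => (\sum_(0 <= i <oo) mu (clamp s) (F i))%E).
    by apply: ge0_emeasurable_sum => // k s _ _; exact: measure_ge0.
  apply/funext => s; rewrite measure_semi_bigcup//.
  exact: bigcup_measurable.
Qed.

Hypothesis (M : R) (mass_le : forall s, 0 <= s <= T -> (mu s setT <= M%:E)%E).

Lemma measurable_clamp_integral (F : timespace R -> \bar R) :
  (forall p, (0 <= F p)%E) -> measurable_fun setT F ->
  measurable_fun setT (fun s : measurableTypeR R =>
    (\int[mu (clamp s)]_z F (s, z))%E).
Proof.
move=> F0 mF.
pose K := fun s : measurableTypeR R => mu (clamp s) : {measure set (plane R) -> \bar R}.
have hK : measure_fam_uub K.
  (* The uniform bound of a finite kernel is strict, whereas M may be attained. *)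
  exists (M + 1) => s; rewrite (@le_lt_trans _ _ M%:E)//; last by rewrite lte_fin ltrDl.
  by apply: mass_le; exact: clamp_itv.
pose k1 := isKernel.Build _ _ _ _ _ K measurable_clamp_set.
pose k : R.-ker _ ~> _ := HB.pack K k1.
pose k2 := @Kernel_isFinite.Build _ _ _ _ _ k hK.
pose k' : R.-fker _ ~> _ := HB.pack K k1 k2.
exact: (@measurable_fun_integral_finite_kernel _ _ _ _ _ F k').
Qed.

Local Notation I := (`[0, T]%classic : set (measurableTypeR R)).
Local Notation D := (I `*` Q : set (timespace R)).
Local Notation leb := (@lebesgue_measure R).

Lemma measurable_time_interval : measurable I.
Proof. exact: measurable_itv. Qed.

Lemma measurable_time_domain : measurable D.
Proof.
by apply: measurableX; [exact: measurable_time_interval|exact: measurable_quadrant].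
Qed.

Lemma measurable_section (F : R * (R * R) -> R) s : 0 <= s <= T ->
  measurable_fun D (F : timespace R -> R) ->
  measurable_fun Q ((fun z => F (s, z)) : plane R -> R).
Proof.
move=> sI mF.
apply: (measurable_comp (g := fun z : plane R => ((s : measurableTypeR R), z))
  measurable_time_domain _ mF).
- by move=> _ [z qz <-]; split => //=; rewrite in_itv.
- by apply: measurable_funTS; apply: measurable_fun_pair.
Qed.

Lemma measurable_bracket (F : R * (R * R) -> R) :
  measurable_fun D (F : timespace R -> R) ->
  measurable_fun I (fun s => bracket (fun z => F (s, z)) (mu s)).
Proof.
move=> mF; have mD := measurable_time_domain.
(* For nonnegative functions, extension by 0 outside the time domain and clamping of the path reduce
   the claim to the kernel; signed functions follow from their positive and negative parts. *)
have aux (G : timespace R -> \bar R) : (forall p, (0 <= G p)%E) ->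
    measurable_fun D G ->
    measurable_fun I (fun s => (\int[mu s]_(z in Q) G (s, z))%E).
  move=> G0 mG.
  have mGD : measurable_fun setT (G \_ D).
    by apply/(measurable_restrictT _ mD).
  have GD0 p : (0 <= (G \_ D) p)%E by rewrite /patch; case: ifP.
  apply: (eq_measurable_fun (fun s => (\int[mu (clamp s)]_z (G \_ D) (s, z))%E)).
    move=> s /set_mem/=; rewrite in_itv/= => sI.
    rewrite clamp_id// [in RHS]integral_mkcond; apply: eq_integral => z _.
    rewrite /patch; congr (if _ then _ else _).
    by apply/idP/idP => /set_mem h; apply/mem_set; [case: h|split=> //=; rewrite in_itv].
  by apply: measurable_funTS; exact: measurable_clamp_integral.
apply: (eq_measurable_fun (fun s =>
  (\int[mu s]_(z in Q) (EFin \o F)^\+ (s, z)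
   - \int[mu s]_(z in Q) (EFin \o F)^\- (s, z))%E)).
  move=> s _; rewrite /bracket/= [in RHS]integralE; congr (_ - _)%E.
    by apply: eq_integral => z _; rewrite !funeposE.
  by apply: eq_integral => z _; rewrite !funenegE.
have mEF : measurable_fun D (EFin \o F : timespace R -> \bar R) by exact/measurable_EFinP.
apply: emeasurable_funB; apply: aux => //.
- exact: measurable_funepos.
- exact: measurable_funeneg.
Qed.

Definition time_bracket (F : R * (R * R) -> R) : \bar R :=
  (\int[leb]_(s in I) bracket (fun z => F (s, z)) (mu s))%E.

Section domination.
Variable H : R * (R * R) -> R.
Hypotheses (mH : measurable_fun D (H : timespace R -> R))
  (H_fin : (time_bracket H < +oo)%E).

(** The bound [H] may be an unbounded function of both variables, later a multiple of the hazard.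
    Finiteness of its double integral makes its bracket finite only at almost every time, so
    identities between time integrals are derived almost everywhere in s. *)
Definition dominated (F : R * (R * R) -> R) : Prop :=
  measurable_fun D (F : timespace R -> R) /\ forall p, D p -> `|F p| <= H p.

Lemma dominated_bracket_integrable F s : 0 <= s <= T -> dominated F ->
  (bracket (fun z => H (s, z)) (mu s) < +oo)%E ->
  (mu s).-integrable Q (fun z => (F (s, z))%:E).
Proof.
move=> sI [mF FH] Hs; apply/integrableP; split.
  by apply/measurable_EFinP; exact: measurable_section.
apply: le_lt_trans Hs; apply: ge0_le_integral => //.
- exact: measurable_quadrant.
- apply/measurable_EFinP; apply: measurableT_comp => //.
  exact: measurable_section.
- by apply/measurable_EFinP; exact: measurable_section.
- by move=> z qz; rewrite lee_fin FH//; split=> //=; rewrite in_itv.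
Qed.

Lemma le_abse_bracket F s : 0 <= s <= T -> dominated F ->
  (`|bracket (fun z => F (s, z)) (mu s)| <= bracket (fun z => H (s, z)) (mu s))%E.
Proof.
move=> sI [mF FH].
have mFs : measurable_fun Q (fun z => (F (s, z))%:E).
  by apply/measurable_EFinP; exact: measurable_section.
apply: le_trans.
  by apply: le_abse_integral => //; exact: measurable_quadrant.
apply: ge0_le_integral => //.
- exact: measurable_quadrant.
- exact: measurableT_comp.
- by apply/measurable_EFinP; exact: measurable_section.
- by move=> z qz; rewrite lee_fin FH//; split=> //=; rewrite in_itv.
Qed.

Lemma dominating_ge0 F p : dominated F -> D p -> 0 <= H p.
Proof. by move=> [_ FH] Dp; rewrite (le_trans _ (FH _ Dp)). Qed.

Lemma dominating_integrable F : dominated F ->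
  leb.-integrable I (fun s => bracket (fun z => H (s, z)) (mu s)).
Proof.
move=> dF; apply/integrableP; split; first exact: measurable_bracket.
apply: le_lt_trans H_fin; rewrite le_eqVlt; apply/orP; left; apply/eqP.
apply: eq_integral => s /set_mem/=; rewrite in_itv/= => sI.
rewrite gee0_abs//; apply: bracket_ge0 => z qz.
by apply: (dominating_ge0 dF); split=> //=; rewrite in_itv.
Qed.

Lemma dominated_integrable F : dominated F ->
  leb.-integrable I (fun s => bracket (fun z => F (s, z)) (mu s)).
Proof.
move=> dF; apply: (@le_integrable _ _ _ _ _ measurable_time_interval _
  (fun s => bracket (fun z => H (s, z)) (mu s))).
- exact: measurable_bracket dF.1.
- move=> s /=; rewrite in_itv/= => sI; apply: (le_trans (le_abse_bracket sI dF)).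
  by rewrite lee_abs.
- exact: dominating_integrable dF.
Qed.

Lemma dominated_ae F : dominated F ->
  {ae leb, forall s, I s -> (bracket (fun z => H (s, z)) (mu s) < +oo)%E}.
Proof.
move=> dF; have := integrable_ae measurable_time_interval (dominating_integrable dF).
by apply: filterS => s h /h; rewrite fin_numE => /andP[_]; rewrite ltey.
Qed.

Lemma time_bracket_fin_num F : dominated F -> time_bracket F \is a fin_num.
Proof.
move=> dF; apply: integrable_fin_num; first exact: measurable_time_interval.
exact: dominated_integrable.
Qed.

Lemma time_bracketD F1 F2 : dominated F1 -> dominated F2 ->
  dominated (fun p => F1 p + F2 p) ->
  time_bracket (fun p => F1 p + F2 p) = (time_bracket F1 + time_bracket F2)%E.
Proof.
move=> d1 d2 d12; have mI := measurable_time_interval.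
rewrite /time_bracket -integralD//; [|exact: dominated_integrable..].
apply: ae_eq_integral => //.
- exact: measurable_bracket d12.1.
- by apply: emeasurable_funD; apply: measurable_bracket; [exact: d1.1|exact: d2.1].
- apply: filterS (dominated_ae d1) => s h sI; have Hs := h sI.
  have sI' : 0 <= s <= T by move: sI; rewrite /= in_itv.
  rewrite /bracket -integralD//; first exact: measurable_quadrant.
  + exact: dominated_bracket_integrable.
  + exact: dominated_bracket_integrable.
Qed.

(** Dominated convergence is applied twice: in z under [H (s, z)] for almost every s, then in s
    under the bracket of [H]. *)
Lemma cvg_time_bracket (F_ : nat -> R * (R * R) -> R) F :
  (forall n, dominated (F_ n)) ->
  (forall p, D p -> F_ ^~ p @ \oo --> F p) ->
  (fun n => time_bracket (F_ n)) @ \oo --> time_bracket F.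
Proof.
move=> dF cF; have mI := measurable_time_interval.
have mF : measurable_fun D (F : timespace R -> R).
  by apply: (measurable_fun_cvg _ cF) => n; exact: (dF n).1.
have [|||||_ _ //] := @dominated_convergence _ _ _ leb _ mI
  (fun n s => bracket (fun z => F_ n (s, z)) (mu s))
  (fun s => bracket (fun z => F (s, z)) (mu s))
  (fun s => bracket (fun z => H (s, z)) (mu s)).
- by move=> n; exact: measurable_bracket (dF n).1.
- exact: measurable_bracket.
- apply: filterS (dominated_ae (dF 0%N)) => s h sI; have Hs := h sI.
  have sI' : 0 <= s <= T by move: sI; rewrite /= in_itv.
  have dH : dominated H.
    by split => // p Dp; rewrite ger0_norm// (dominating_ge0 (dF 0%N)).
  have [|||||_ _ //] := @dominated_convergence _ _ _ (mu s) _ (@measurable_quadrant R)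
    (fun n z => (F_ n (s, z))%:E) (fun z => (F (s, z))%:E) (fun z => (H (s, z))%:E).
  + by move=> n; apply/measurable_EFinP; exact: measurable_section (dF n).1.
  + by apply/measurable_EFinP; exact: measurable_section.
  + apply/aeW => z qz; apply: cvg_EFin; first exact: nearW.
    by apply: cF.
  + exact: dominated_bracket_integrable.
  + by apply/aeW => z n qz; rewrite lee_fin; apply: (dF n).2.
- exact: dominating_integrable (dF 0%N).
- by apply/aeW => s n /=; rewrite in_itv/= => sI; exact: le_abse_bracket.
Qed.

End domination.

End cadlag_kernel.

(** * Sign and measurability of the hazard rates *)

Section hazard_rates.
Context {R : realType} (g : R * R -> R).
Hypotheses (g_density : is_density g) (Sg_C1 : C1_quadrant (Sg g)).

Local Notation Q := (quadrant : set (plane R)).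
Local Notation upper z :=
  ((`[(z : R * R).1, +oo[ `*` `[(z : R * R).2, +oo[)%classic : set (plane R)).

Lemma measurable_upper (z : R * R) : measurable (upper z).
Proof. by apply: measurableX; exact: measurable_itv. Qed.

Lemma upper_sub (z w : R * R) : z.1 <= w.1 -> z.2 <= w.2 -> upper w `<=` upper z.
Proof.
move=> h1 h2 [x y] []/=; rewrite !in_itv/= !andbT => wx wy; split => /=.
  exact: le_trans h1 wx.
exact: le_trans h2 wy.
Qed.

Lemma upper_sub_quadrant (z : R * R) : quadrant z -> upper z `<=` Q.
Proof.
move=> /quadrantP[z1 z2] [x y] []/=; rewrite !in_itv/= !andbT => zx zy.
by apply/quadrantP => /=; rewrite (le_trans z1) ?(le_trans z2).
Qed.

(** [Sg] is the [fine] part of an extended integral; total mass 1 of the density makes that integral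
    finite, so nothing is lost. *)
Lemma Sg_integral (z : R * R) : quadrant z ->
  (Sg g z)%:E = (\int[@leb2 R]_(w in upper z) (g w)%:E)%E.
Proof.
move=> qz; rewrite /Sg /Rintegral fineK//.
have [mg g0 g1] := g_density.
have mz := measurable_upper z.
rewrite ge0_fin_numE.
  apply: (@le_lt_trans _ _ 1%E); last exact: ltry.
  rewrite -g1; apply: ge0_subset_integral => //.
  - exact: measurable_quadrant.
  - exact/measurable_EFinP.
  - exact: upper_sub_quadrant.
by apply: integral_ge0 => w /(upper_sub_quadrant qz) qw; rewrite lee_fin g0.
Qed.

Lemma Sg_ge0 (z : R * R) : quadrant z -> 0 <= Sg g z.
Proof.
move=> qz; rewrite -lee_fin Sg_integral//; apply: integral_ge0 => w.
have [_ g0 _] := g_density.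
by move=> /(upper_sub_quadrant qz) qw; rewrite lee_fin g0.
Qed.

Lemma Sg_le (z w : R * R) : quadrant z -> z.1 <= w.1 -> z.2 <= w.2 ->
  Sg g w <= Sg g z.
Proof.
move=> qz h1 h2; have /quadrantP[z1 z2] := qz.
have qw : quadrant w.
  by apply/quadrantP; rewrite (le_trans z1) ?(le_trans z2).
rewrite -lee_fin !Sg_integral//; have [mg g0 g1] := g_density.
apply: ge0_subset_integral.
- exact: measurable_upper.
- exact: measurable_upper.
- apply/measurable_EFinP; apply: measurable_funS mg.
    exact: measurable_quadrant.
  exact: upper_sub_quadrant.
- by move=> x /(upper_sub_quadrant qz) qx; rewrite lee_fin g0.
- exact: upper_sub.
Qed.

Lemma Ug_mem (z : R * R) : quadrant z -> (z \in Ug g) = (0 < Sg g z).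
Proof.
move=> qz; apply/idP/idP => [/set_mem[]//|h].
by apply/mem_set; split.
Qed.

(* Where [Sg] vanishes the right-hand side is 0, like [hgx], because 0^-1 = 0. *)
Lemma hgxE (z : R * R) : quadrant z -> hgx g z = - pdx (Sg g) z / Sg g z.
Proof.
move=> qz; have /quadrantP[z1 z2] := qz; rewrite /hgx Ug_mem//.
case: ifPn => [S0|].
  have [_ d _ _] := Sg_C1; have [dx _] := d z qz.
  have dl : is_derive (Sg g (z.1, z.2)) (1 : R) (@ln R) (Sg g z)^-1.
    by rewrite -surjective_pairing; exact: is_derive1_ln.
  rewrite /pdx (is_dplus_derive z1 (is_dplus_comp (derivable_plus_is_dplus dx) dl)).
  by rewrite mulNr mulrC.
rewrite -leNgt => S0; have -> : Sg g z = 0.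
  by apply/eqP; rewrite eq_le S0 Sg_ge0.
by rewrite invr0 mulr0.
Qed.

Lemma hgyE (z : R * R) : quadrant z -> hgy g z = - pdy (Sg g) z / Sg g z.
Proof.
move=> qz; have /quadrantP[z1 z2] := qz; rewrite /hgy Ug_mem//.
case: ifPn => [S0|].
  have [_ d _ _] := Sg_C1; have [_ dy] := d z qz.
  have dl : is_derive (Sg g (z.1, z.2)) (1 : R) (@ln R) (Sg g z)^-1.
    by rewrite -surjective_pairing; exact: is_derive1_ln.
  rewrite /pdy (is_dplus_derive z2 (is_dplus_comp (derivable_plus_is_dplus dy) dl)).
  by rewrite mulNr mulrC.
rewrite -leNgt => S0; have -> : Sg g z = 0.
  by apply/eqP; rewrite eq_le S0 Sg_ge0.
by rewrite invr0 mulr0.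
Qed.

(** The domain of integration in [Sg] shrinks as a coordinate grows, so [Sg] has nonpositive partial
    derivatives. *)
Lemma hgx_ge0 (z : R * R) : quadrant z -> 0 <= hgx g z.
Proof.
move=> qz; rewrite hgxE// mulr_ge0 ?invr_ge0 ?Sg_ge0// oppr_ge0.
have /quadrantP[z1 z2] := qz.
have [_ d _ _] := Sg_C1; have [dx _] := d z qz.
apply: (is_dplus_le0 z1 _ (derivable_plus_is_dplus dx)) => x y x0 xy.
by apply: Sg_le => //; apply/quadrantP.
Qed.

Lemma hgy_ge0 (z : R * R) : quadrant z -> 0 <= hgy g z.
Proof.
move=> qz; rewrite hgyE// mulr_ge0 ?invr_ge0 ?Sg_ge0// oppr_ge0.
have /quadrantP[z1 z2] := qz.
have [_ d _ _] := Sg_C1; have [_ dy] := d z qz.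
apply: (is_dplus_le0 z2 _ (derivable_plus_is_dplus dy)) => x y x0 xy.
by apply: Sg_le => //; apply/quadrantP.
Qed.

Lemma hazard_ge0 (m : MFplus R) (z : R * R) : quadrant z -> 0 <= hazard g m z.
Proof.
move=> qz; rewrite /hazard; apply: addr_ge0; last exact: hgy_ge0.
by apply: mulr_ge0; [rewrite /rbar ler0n|exact: hgx_ge0].
Qed.

Lemma measurable_Sg : measurable_fun Q (Sg g : plane R -> R).
Proof. by apply: quadrant_continuous_measurable; case: Sg_C1. Qed.

Lemma measurable_Ugc : measurable (Ugc g : set (plane R)).
Proof.
have mQ := @measurable_quadrant R.
rewrite (_ : Ugc g = Q `&` (Sg g : plane R -> R) @^-1` `]-oo, 0]).
  by apply: measurable_Sg => //; exact: measurable_itv.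
apply/seteqP; split=> [z [qz Uz]|z [qz]] /=; rewrite ?in_itv/=.
  by split => //; rewrite leNgt; apply/negP => S0; apply: Uz.
by move=> S0; split => // -[_]; rewrite ltNge S0.
Qed.

(** The continuous functions x / (x^2 + 1/(n+1)) converge to the inverse everywhere, also at 0,
    where both sides are 0 by the convention on [0^-1]. *)
Lemma measurable_inv : measurable_fun setT (fun x : R => x^-1).
Proof.
have den (n : nat) (x : R) : 0 < x ^+ 2 + n.+1%:R^-1.
  by rewrite ltr_wpDl ?sqr_ge0// invr_gt0.
apply: (@measurable_fun_cvg _ _ _ _ (fun n (x : R) => x / (x ^+ 2 + n.+1%:R^-1))).
  move=> n; apply: continuous_measurable_fun => x.
  apply: cvgM; first exact: cvg_id.
  apply: cvgV; first by rewrite gt_eqF.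
  apply: cvgD; last exact: cvg_cst.
  exact: exprn_continuous.
move=> x _; have [->|x0] := eqVneq x 0.
  by rewrite invr0; under eq_fun do rewrite mul0r; exact: cvg_cst.
rewrite [X in _ --> X](_ : _ = x / (x ^+ 2 + 0)); last first.
  by rewrite addr0 expr2 invfM mulrA divff// mul1r.
apply: cvgM; first exact: cvg_cst.
apply: cvgV; first by rewrite addr0 expf_eq0.
by apply: cvgD; [exact: cvg_cst|exact: cvg_harmonic].
Qed.

Lemma measurable_hgx : measurable_fun Q (hgx g : plane R -> R).
Proof.
apply: (eq_measurable_fun (fun z : plane R => - pdx (Sg g) z * (Sg g z)^-1)).
  by move=> z /set_mem qz; rewrite hgxE.
have [_ _ c _] := Sg_C1; apply: measurable_funM.
  apply: measurableT_comp; last exact: quadrant_continuous_measurable.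
  exact: oppr_measurable.
by apply: measurableT_comp; [exact: measurable_inv|exact: measurable_Sg].
Qed.

Lemma measurable_hgy : measurable_fun Q (hgy g : plane R -> R).
Proof.
apply: (eq_measurable_fun (fun z : plane R => - pdy (Sg g) z * (Sg g z)^-1)).
  by move=> z /set_mem qz; rewrite hgyE.
have [_ _ _ c] := Sg_C1; apply: measurable_funM.
  apply: measurableT_comp; last exact: quadrant_continuous_measurable.
  exact: oppr_measurable.
by apply: measurableT_comp; [exact: measurable_inv|exact: measurable_Sg].
Qed.

End hazard_rates.

(** * Arithmetic of balance equations in the extended reals *)

Lemma ereal_subtract_balance (R : realType) (b x a1 a2 h1 h2 t1 t2 : \bar R) :
  b \is a fin_num -> a1 \is a fin_num -> a2 \is a fin_num ->
  h1 \is a fin_num -> h2 \is a fin_num ->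
  t1 \is a fin_num -> t2 \is a fin_num ->
  (a1 + a2 = b + x - (h1 + h2) + (t1 + t2))%E -> (a1 = x - h1 + t1)%E ->
  (a2 = b - h2 + t2)%E.
Proof.
case: b => // b _; case: a1 => // a1 _; case: a2 => // a2 _; case: h1 => // h1 _.
case: h2 => // h2 _; case: t1 => // t1 _; case: t2 => // t2 _; case: x => // x.
rewrite -!EFinN -!EFinD => -[e1] [e2]; congr EFin; lra.
Qed.

Lemma ler_dist4 (R : realFieldType) (a b c d f e : R) :
  `|a - b| <= e / 4 -> `|b - c| <= e / 4 -> `|c - d| <= e / 4 ->
  `|d - f| <= e / 4 -> `|a - f| <= e.
Proof.
rewrite !ler_norml => /andP[? ?] /andP[? ?] /andP[? ?] /andP[? ?].
by apply/andP; split; lra.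
Qed.

Lemma cvg_balance (R : realType) (u v w : nat -> \bar R) (x y z : \bar R) (c : R) :
  u @ \oo --> x -> v @ \oo --> y -> w @ \oo --> z ->
  y \is a fin_num -> z \is a fin_num ->
  (fun n => (c%:E * u n - v n + w n)%E) @ \oo --> (c%:E * x - y + z)%E.
Proof.
move=> ux vy wz fy fz; apply: cvgeD => //; first exact: fin_num_adde_defl.
apply: cvgeB => //; last exact: cvgeZl.
by apply: fin_num_adde_defl; rewrite fin_numN.
Qed.

Section integral_sign.
Context d (X : measurableType d) (R : realType) (m : {measure set X -> \bar R}).

Lemma integral_le0 (D : set X) (f : X -> \bar R) :
  (forall x, D x -> (f x <= 0)%E) -> (\int[m]_(x in D) f x <= 0)%E.
Proof.
move=> f0; rewrite (_ : (\int[m]_(x in D) f x)%E =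
    (\int[m]_(x in D) - (- f x))%E); last first.
  by apply: eq_integral => x _; rewrite oppeK.
rewrite integral_ge0N; last by move=> x Dx; rewrite oppe_ge0 f0.
by rewrite oppe_le0 integral_ge0// => x Dx; rewrite oppe_ge0 f0.
Qed.

End integral_sign.

(** * Restriction of measures to y < t and y >= t, and its effect on the service threshold *)

Section restriction.
Context {R : realType}.
Implicit Types (m : MFplus R) (f : R * R -> R).

Local Notation Q := (quadrant : set (plane R)).

Lemma mrestr_fin_num_fun m (A : set (plane R)) (mA : measurable A) :
  fin_num_fun (mrestr m mA).
Proof. by move=> B mB; apply: mf_fin_num; exact: measurableI. Qed.

Definition mrestr_finite m (A : set (plane R)) (mA : measurable A) :
    {finite_measure set (plane R) -> \bar R} :=
  HB.pack (mrestr m mA)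
    (Measure_isFinite.Build _ _ _ (mrestr m mA) (mrestr_fin_num_fun m mA)).

Lemma mrestr_carried m (A : set (plane R)) (mA : measurable A) :
  mrestr_finite m mA (~` quadrant) = 0%E.
Proof.
apply/eqP; rewrite eq_le measure_ge0 andbT -(mf_carried m).
have mQ := measurableC (@measurable_quadrant R).
rewrite /= /mrestr; apply: le_measure; rewrite ?inE//; exact: measurableI.
Qed.

Definition restr m (A : set (plane R)) (mA : measurable A) : MFplus R :=
  Build_MFplus (mrestr_carried m mA).

Lemma restrE m (A B : set (plane R)) (mA : measurable A) :
  restr m mA B = m (B `&` A).
Proof. by []. Qed.

Lemma bracket_restr m f (A : set (plane R)) (mA : measurable A) :
  measurable_fun Q (f : plane R -> R) ->
  bracket f (restr m mA) = bracket (fun z => f z * \1_A z) m.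
Proof.
move=> mf; have mQ := @measurable_quadrant R.
have mfE : measurable_fun Q (EFin \o f : plane R -> \bar R) by exact/measurable_EFinP.
have mQA : measurable (Q `&` A) by exact: measurableI.
have mQD : measurable (Q `\` A) by exact: measurableD.
have QE : Q = (Q `&` A) `|` (Q `\` A) by rewrite setUIDK.
rewrite /bracket [in LHS]QE integral_setU//; last 2 first.
- by rewrite -QE.
- by rewrite disj_set2E setDE setIACA setICr setI0.
rewrite (@null_set_integral _ _ _ _ (Q `\` A)) ?adde0//; last 2 first.
- by apply: measurable_funS mfE => //; exact: subDsetl.
- by rewrite /= /mrestr setDE -setIA setICl setI0 measure0.
rewrite (@eq_measure_integral _ _ _ _ m); last first.
  by move=> B mB BA; rewrite /= /mrestr setIidl// => z /BA[].
rewrite integral_mkcondr; apply: eq_integral => z _.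
by rewrite /patch indicE; case: ifPn => _; rewrite ?mulr1 ?mulr0.
Qed.

(** The inequality is strict so that no point of the quadrant is young at time 0; [eta n (t - y)]
    increases to exactly this indicator. *)
Definition young (t : R) : set (plane R) := [set z | z.2 < t].

Lemma measurable_young t : measurable (young t).
Proof.
rewrite (_ : young t = setT `&` (snd @^-1` `]-oo, t[)).
  by apply: measurable_snd => //; exact: measurable_itv.
by apply/seteqP; split => z; rewrite /young/= in_itv/= => // -[].
Qed.

Lemma measurable_old t : measurable (~` young t).
Proof. by apply: measurableC; exact: measurable_young. Qed.

Definition young_part m t : MFplus R := restr m (measurable_young t).
Definition old_part m t : MFplus R := restr m (measurable_old t).

Lemma le_ystarP m y : (y%:E <= ystar m)%E <->
  forall y', 0 <= y' -> (1 <= m (Rplus `*` `[0%R, y']))%E -> y <= y'.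
Proof.
split=> [h y' y'0 my'|h]; last first.
  by apply: le_ereal_inf_tmp => _ [y' [y'0 my'] <-]; rewrite lee_fin h.
rewrite -lee_fin (le_trans h)//; apply: ereal_inf_lbound.
by exists y'.
Qed.

Lemma measurable_strip (y : R) : measurable (Rplus `*` `[0%R, y] : set (plane R)).
Proof. by apply: measurableX; exact: measurable_itv. Qed.

Lemma le_strip m (y y' : R) : y <= y' ->
  (m (Rplus `*` `[0%R, y]) <= m (Rplus `*` `[0%R, y']))%E.
Proof.
move=> yy'; apply: le_measure; rewrite ?inE; [exact: measurable_strip..|].
by move=> [a b] [/= ? ] /=; rewrite !in_itv/= => /andP[-> /le_trans->].
Qed.

(** Strip masses are monotone, so a real threshold below y that violates the condition can be
    replaced by a rational between it and y. The countable form is what makes [rbar] jointly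
    measurable in time and space. *)
Lemma le_ystar_ratP m y : (y%:E <= ystar m)%E <->
  forall q : rat, 0 <= (ratr q : R) -> (1 <= m (Rplus `*` `[0%R, ratr q]))%E ->
    y <= ratr q.
Proof.
split => [/le_ystarP h q|h]; first exact: h.
apply/le_ystarP => y' y'0 my'; rewrite leNgt; apply/negP => y'y.
have [q] := rat_in_itvoo y'y; rewrite in_itv/= => /andP[y'q qy].
have := h q (le_trans y'0 (ltW y'q)) (le_trans my' (le_strip m (ltW y'q))).
by rewrite leNgt qy.
Qed.

(** Strips of height y' < t have the same mass before and after restriction, and thresholds y' >= t
    satisfy y <= y' anyway because y < t. *)
Lemma rbar_young m t y : y < t -> rbar (young_part m t) y = rbar m y.
Proof.
move=> yt; rewrite /rbar; congr (nat_of_bool _)%:R.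
have sub y' : y' < t -> young_part m t (Rplus `*` `[0%R, y']) = m (Rplus `*` `[0%R, y']).
  move=> y't; rewrite restrE setIidl// => -[a b] [_] /=.
  by rewrite in_itv/= => /andP[_ by']; exact: le_lt_trans y't.
apply/idP/idP => /le_ystarP h; apply/le_ystarP => y' y'0 my'.
- by have [y't|ty'] := ltP y' t; [apply: h; rewrite ?sub|rewrite ltW// (lt_le_trans yt)].
- by have [y't|ty'] := ltP y' t; [apply: h; rewrite -?sub|rewrite ltW// (lt_le_trans yt)].
Qed.

Lemma measurable_rbar m : measurable_fun Q ((fun z => rbar m z.2) : plane R -> R).
Proof.
pose E : set (plane R) := [set z | (z.2%:E <= ystar m)%E].
have mE : measurable E.
  rewrite (_ : E = setT `&` ((EFin \o snd) @^-1` `]-oo, ystar m]%E%classic)).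
    have mf : measurable_fun (setT : set (plane R)) (EFin \o snd).
      have ms : measurable_fun setT (snd : plane R -> R) by exact: measurable_snd.
      exact/measurable_EFinP.
    by apply: mf => //; exact: emeasurable_itv.
  by apply/seteqP; split => z; rewrite /E/= in_itv/= => // -[].
apply: (eq_measurable_fun (\1_E : plane R -> R)).
  move=> z _; rewrite indicE /rbar /E; congr (nat_of_bool _)%:R.
  by apply/idP/idP => [/set_mem|h]; [|apply/mem_set].
by apply: measurable_funTS; exact: measurable_indic.
Qed.

End restriction.

(** * Uniform bounds for test functions and their transport *)

Section bounded_test_functions.
Context {R : realType} (phi : R * (R * R) -> R).
Hypothesis phi_C1c : C1c_octant phi.

Let K := closure [set p | octant p /\ phi p != 0].

Lemma closed_octant : closed (octant : set (R * (R * R))).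
Proof.
have cR : closed (Rplus : set R) by exact: interval_closed.
have cX (S U : topologicalType) (A : set S) (B : set U) :
    closed A -> closed B -> closed (A `*` B).
  move=> cA cB; have -> : A `*` B = (fst @^-1` A) `&` (snd @^-1` B) by [].
  apply: closedI; apply: preimage_closed => // p _; [exact: cvg_fst|exact: cvg_snd].
by apply: (cX) => //; exact: cX.
Qed.

Lemma support_sub_octant : K `<=` octant.
Proof.
rewrite [X in _ `<=` X](closure_id _).1; last exact: closed_octant.
by apply: closure_subset => p [].
Qed.

Lemma derive_plus_eq0 (f : R -> R) (a : R) : 0 <= a ->
  (\forall u \near a, 0 <= u -> f u = 0) -> derive_plus f a = 0.
Proof.
move=> a0 f0; apply: is_dplus_derive => //.
have fa : f a = 0 by exact: (nbhs_singleton f0).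
have FF := within_Rplus_filter a.
have hc : (fun=> 0 : R) @ within Rplus a^' --> (0 : R) by exact: cvg_cst.
apply: cvg_trans hc; apply: (@near_eq_cvg _ _ (within Rplus a^')).
have : nbhs a (fun u => u != a -> Rplus u -> 0 = diff_quot f a u).
  apply: (@filterS _ (nbhs a) _ _ _ _ f0) => u fu _ /RplusP u0.
  by rewrite /diff_quot fa fu// subrr mul0r.
by [].
Qed.

Lemma continuous_pair (X U V : topologicalType) (f : X -> U) (h : X -> V) x :
  {for x, continuous f} -> {for x, continuous h} ->
  {for x, continuous (fun t => (f t, h t))}.
Proof. by move=> cf ch; exact: (cvg_pair cf ch). Qed.

Lemma near_coordinates (P : R * (R * R) -> Prop) (s x y : R) :
  (\forall p \near (s, (x, y)), P p) ->
  [/\ \forall u \near s, P (u, (x, y)), \forall u \near x, P (s, (u, y)) &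
      \forall u \near y, P (s, (x, u))].
Proof.
move=> nP; split.
- have c : {for s, continuous (fun u : R => (u, (x, y)))}.
    by apply: continuous_pair; [exact: cvg_id|exact: cvg_cst].
  exact: c _ nP.
- have c : {for x, continuous (fun u : R => (s, (u, y)))}.
    apply: continuous_pair; first exact: cvg_cst.
    by apply: continuous_pair; [exact: cvg_id|exact: cvg_cst].
  exact: c _ nP.
- have c : {for y, continuous (fun u : R => (s, (x, u)))}.
    apply: continuous_pair; first exact: cvg_cst.
    by apply: continuous_pair; [exact: cvg_cst|exact: cvg_id].
  exact: c _ nP.
Qed.

Lemma partials_eq0 s x y : octant (s, (x, y)) -> ~ K (s, (x, y)) ->
  [/\ phi_t phi (s, (x, y)) = 0, phi_x phi (s, (x, y)) = 0 &
      phi_y phi (s, (x, y)) = 0].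
Proof.
move=> /octantP[s0 x0 y0] nK.
have nbK : \forall p \near (s, (x, y)), octant p -> phi p = 0.
  have : open (~` K) by apply: closed_openC; exact: closed_closure.
  rewrite openE => /(_ _ nK); apply: filterS => p nKp op.
  apply/eqP; apply/negPn/negP => h; apply: nKp.
  by apply: subset_closure; split.
have [ns nx ny] := near_coordinates nbK.
split; apply: derive_plus_eq0 => //.
- by apply: filterS ns => u h u0; apply: h; apply/octantP.
- by apply: filterS nx => u h u0; apply: h; apply/octantP.
- by apply: filterS ny => u h u0; apply: h; apply/octantP.
Qed.

(** Continuity is known only within the octant. The octant is closed, so the support stays inside it
    and compactness can be used there. *)
Lemma continuous_bounded_support (F : R * (R * R) -> R) :
  {within octant, continuous F} -> (forall p, octant p -> ~ K p -> F p = 0) ->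
  exists2 C : R, 0 <= C & forall p, octant p -> `|F p| <= C.
Proof.
move=> cF F0; have [_ _ _ cK] := phi_C1c.
have cFK : {within K, continuous F}.
  exact: continuous_subspaceW support_sub_octant cF.
have /compact_bounded[C [_ hC]] := continuous_compact cFK cK.
exists (`|C| + 1) => [|p op]; first by rewrite addr_ge0.
have [Kp|nKp] := pselect (K p); last by rewrite F0// normr0 addr_ge0.
apply: (hC (`|C| + 1)); last by exists p.
by rewrite (le_lt_trans (ler_norm C))// ltrDl.
Qed.

Lemma test_bounded :
  exists2 C : R, 0 <= C & forall p, octant p -> `|phi p| <= C.
Proof.
apply: continuous_bounded_support; first by case: phi_C1c.
move=> p op np; apply/eqP; apply/negPn/negP => h; apply: np.
by apply: subset_closure; split.
Qed.

(** The bound is uniform over measures because [rbar] takes only the values 0 and 1. *)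
Lemma transport_bounded :
  exists2 C : R, 0 <= C & forall m s z, octant (s, z) ->
    `|transport m phi s z| <= C.
Proof.
have [_ _ [ct cx cy] _] := phi_C1c.
have [|Ct Ct0 ht] := continuous_bounded_support ct.
  by move=> [s [x y]] o n; have [] := partials_eq0 o n.
have [|Cx Cx0 hx] := continuous_bounded_support cx.
  by move=> [s [x y]] o n; have [] := partials_eq0 o n.
have [|Cy Cy0 hy] := continuous_bounded_support cy.
  by move=> [s [x y]] o n; have [] := partials_eq0 o n.
exists (Ct + Cx + Cy) => [|m s z o]; first by rewrite !addr_ge0.
rewrite /transport (le_trans (ler_normD _ _))// lerD ?hy//.
rewrite (le_trans (ler_normD _ _))// lerD ?ht// normrM.
rewrite -[leRHS]mul1r ler_pM ?hx// /rbar normr_nat.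
by case: (_ <= _)%E.
Qed.

End bounded_test_functions.

(** * Comparison in s - y, total mass, and the layer just below y = t *)

Section fluid_solution.
Context {R : realType} (lambda0 : R) (g : R * R -> R) (mu : R -> MFplus R).
Hypotheses (lambda0_ge0 : 0 <= lambda0) (g_density : is_density g)
  (Sg_C1 : C1_quadrant (Sg g)) (mu_solution : solution lambda0 g mu).

Local Notation Q := (quadrant : set (plane R)).
Local Notation leb := (@lebesgue_measure R).
Local Notation I t := (`[0, t]%classic : set (measurableTypeR R)).

Lemma measurable_continuous_age (e : R -> R) s : continuous e ->
  measurable_fun Q ((fun z => e (s - z.2)) : plane R -> R).
Proof.
move=> ce; apply: quadrant_continuous_measurable; apply: continuous_subspaceT => z.
apply: (@continuous_comp _ _ _ (fun z : R * R => s - z.2) e); last exact: ce.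
by apply: cvgB; [exact: cvg_cst|exact: cvg_snd].
Qed.

Lemma solution_dynamics t phi : 0 <= t -> C1c_octant phi ->
  (bracket (fun z => phi (t, z)) (mu t) =
   bracket (fun z => phi (0%R, z)) (mu 0%R)
   + lambda0%:E * \int[leb]_(s in I t) (phi (s, (0%R, 0%R)))%:E
   - \int[leb]_(s in I t) bracket (fun z => phi (s, z) * hazard g (mu s) z)%R (mu s)
   + \int[leb]_(s in I t) bracket (transport (mu s) phi s) (mu s))%E.
Proof. by case: mu_solution => _ [_ _ _]; exact. Qed.

Lemma le_bracket m (f h : R * R -> R) :
  measurable_fun Q (f : plane R -> R) -> measurable_fun Q (h : plane R -> R) ->
  (forall z, Q z -> 0 <= f z) -> (forall z, Q z -> f z <= h z) ->
  (bracket f m <= bracket h m)%E.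
Proof.
move=> mf mh f0 fh; apply: ge0_le_integral.
- exact: measurable_quadrant.
- by move=> z qz; rewrite lee_fin f0.
- exact/measurable_EFinP.
- exact/measurable_EFinP.
- by move=> z qz; rewrite lee_fin fh.
Qed.

(* Testing with [e (s - y)] times a cutoff that decreases along the transport:
   the transport and loss terms are then both of the favourable sign. *)
Lemma age_comparison (e e' : R -> R) (C t : R) : C1_pair e e' ->
  (forall u, 0 <= e u <= C) -> 0 <= t ->
  (bracket (fun z => e (t - z.2)%R) (mu t) <=
   bracket (fun z => e (0 - z.2)%R) (mu 0)
   + lambda0%:E * \int[leb]_(s in I t) (e s)%:E)%E.
Proof.
move=> Ce eC t0; have ce := C1_pair_continuous Ce.
have e0 u : 0 <= e u by have /andP[] := eC u.
pose phi k p := @box_cutoff R k p * e (age p).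
have Cphi k : C1c_octant (phi k) by apply: C1c_mul_age Ce; exact: C1c_box_cutoff.
have phi0 k p : 0 <= phi k p by rewrite mulr_ge0// box_cutoff_ge0.
have phie k p : octant p -> phi k p <= e (age p).
  by move=> op; rewrite ler_piMl// box_cutoff_le1.
have mphi k s : 0 <= s -> measurable_fun Q ((fun z => phi k (s, z)) : plane R -> R).
  move=> s0; have [c _ _ _] := Cphi k.
  apply: (measurable_comp (g := fun z : plane R => ((s : measurableTypeR R), z))
    (@measurable_octant R) _ (octant_continuous_measurable c)).
  - by move=> _ [z qz <-]; split => //=; apply/RplusP.
  - by apply: measurable_funTS; apply: measurable_fun_pair.
have le k : (bracket (fun z => phi k (t, z)) (mu t) <=
   bracket (fun z => e (0 - z.2)%R) (mu 0)
   + lambda0%:E * \int[leb]_(s in I t) (e s)%:E)%E.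
  rewrite (solution_dynamics t0 (Cphi k)).
  have h1 : (bracket (fun z => phi k (0%R, z)) (mu 0) <=
      bracket (fun z => e (0 - z.2)%R) (mu 0))%E.
    apply: le_bracket => //; first exact: mphi.
      exact: measurable_continuous_age.
    by move=> z qz; apply: phie; split => //; apply/RplusP.
  have h2 : (\int[leb]_(s in I t) (phi k (s, (0%R, 0%R)))%:E <=
      \int[leb]_(s in I t) (e s)%:E)%E.
    apply: ge0_le_integral => //.
    - by move=> s _; rewrite lee_fin.
    - apply/measurable_EFinP; have [c _ _ _] := Cphi k.
      apply: (measurable_comp (g := fun s : measurableTypeR R =>
          ((s, (0, 0)) : timespace R))
        (@measurable_octant R) _ (octant_continuous_measurable c)).
      + by move=> _ [s /= + <-]; rewrite in_itv/= => /andP[s0 _]; apply/octantP.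
      + by apply: measurable_funTS; apply: measurable_fun_pair.
    - apply/measurable_EFinP; apply: measurable_funTS.
      exact: continuous_measurable_fun.
    - move=> s /=; rewrite in_itv/= => /andP[s0 _]; rewrite lee_fin.
      by rewrite (le_trans (phie _ _ _)) ?/age ?subr0//; apply/octantP.
  have h3 : (0 <= \int[leb]_(s in I t)
      bracket (fun z => phi k (s, z) * hazard g (mu s) z)%R (mu s))%E.
    apply: integral_ge0 => s _; apply: bracket_ge0 => z qz.
    by rewrite mulr_ge0// hazard_ge0.
  have h4 : (\int[leb]_(s in I t) bracket (transport (mu s) (phi k) s) (mu s) <= 0)%E.
    apply: integral_le0 => s /=; rewrite in_itv/= => /andP[s0 _].
    apply: integral_le0 => z qz; rewrite lee_fin.
    have o : octant (s, z) by split => //; apply/RplusP.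
    rewrite (transport_mul_age _ (C1c_box_cutoff k) Ce o).
    by rewrite mulr_le0_ge0// transport_box_cutoff_le0.
  rewrite -[leRHS]adde0; apply: leeD => //.
  rewrite -[leRHS]adde0; apply: leeD; last by rewrite oppe_le0.
  by apply: leeD => //; apply: lee_wpmul2l.
(* The upper bound in [le] is free of k, so only the left side has to follow the removal of the
   cutoff. *)
apply: (cvge_to_le (a := \oo) (f := fun k =>
  bracket (fun z => phi k (t, z)) (mu t))); last exact: nearW.
apply: (@cvg_bracket _ _ _ _ C) => [k|k z qz|z qz].
- exact: mphi.
- have o : octant (t, z) by split => //; apply/RplusP.
  rewrite ger0_norm// (le_trans (phie _ _ o))//.
  by have /andP[] := eC (age (t, z)).
- rewrite -[X in _ --> X]mul1r; apply: cvgM; last exact: cvg_cst.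
  exact: cvg_box_cutoff.
Qed.

(** This is the constant profile e = 1: mass enters at rate [lambda0] and is otherwise only lost. *)
Lemma mass_bound t : 0 <= t ->
  (mu t setT <= mu 0 setT + (lambda0 * t)%:E)%E.
Proof.
move=> t0; have C1 : C1_pair (fun=> 1 : R) (fun=> 0 : R).
  by split => u; [exact: is_derive_cst|exact: cvg_cst].
have := age_comparison (C := 1) C1 _ t0.
rewrite !bracket_cst !mul1e integral_cst//= mul1e lebesgue_measure_itv/= lte_fin.
have [t00|t00] := ltP 0 t; first by rewrite sube0 EFinM; apply => u; rewrite ler01 lexx.
have -> : t = 0 by apply/eqP; rewrite eq_le t0 t00.
by rewrite mule0 mulr0; apply => u; rewrite ler01 lexx.
Qed.

(** The endpoint 0 is excluded because [eta n 0] is 0 for every n; on the half-open interval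
    [eta n s] tends to 1 at every point. *)
Local Notation J t := (`]0%R, t]%classic : set (measurableTypeR R)).

Lemma measurable_one_sub_eta (A : set R) n :
  measurable_fun (A : set (measurableTypeR R)) (fun s : R => 1 - eta n s).
Proof.
apply: measurable_funTS; apply: continuous_measurable_fun => u.
apply: cvgB; first exact: cvg_cst.
exact: (C1_pair_continuous (@C1_pair_eta R n)).
Qed.

Lemma lebesgue_itv_lty (T : R) : (leb (J T) < +oo)%E.
Proof. by rewrite lebesgue_measure_itv/=; case: ifP => // _; rewrite ltry. Qed.

Lemma integrable_one_sub_eta (T : R) n :
  leb.-integrable (J T) (fun s => (1 - eta n s)%:E).
Proof.
apply: measurable_bounded_integrable => //.
- exact: lebesgue_itv_lty.
- exact: measurable_one_sub_eta.
- exists 1; split; first exact: num_real.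
  move=> M M1 u _ /=; rewrite ger0_norm ?subr_ge0 ?eta_le1//.
  by rewrite (le_trans _ (ltW M1))// gerBl eta_ge0.
Qed.

(** An upper bound for the mass entering during (0, T] that the profile [eta n] fails to count. *)
Definition boundary_layer (T : R) (n : nat) : R :=
  lambda0 * fine (\int[leb]_(s in J T) (1 - eta n s)%:E)%E.

Lemma boundary_layerE T n : (boundary_layer T n)%:E =
  (lambda0%:E * \int[leb]_(s in J T) (1 - eta n s)%:E)%E.
Proof.
by rewrite /boundary_layer EFinM fineK//; apply: integrable_fin_num => //;
  exact: integrable_one_sub_eta.
Qed.

Lemma cvg_boundary_layer (T : R) : boundary_layer T @ \oo --> (0 : R).
Proof.
rewrite /boundary_layer -[X in _ --> X](mulr0 lambda0); apply: cvgM; first exact: cvg_cst.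
have mJ : measurable (J T) by exact: measurable_itv.
have [|||||_ _] := @dominated_convergence _ _ _ leb _ mJ
  (fun n s => (1 - eta n s)%:E) (fun=> 0%E) (fun=> 1%E).
- by move=> n; apply/measurable_EFinP; exact: measurable_one_sub_eta.
- exact: measurable_cst.
- apply/aeW => s /=; rewrite in_itv/= => /andP[s0 _].
  apply: cvg_EFin; first exact: nearW.
  rewrite -[X in _ --> X](subrr (1 : R)); apply: cvgB; first exact: cvg_cst.
  exact: cvg_eta.
- apply/integrableP; split; first exact: measurable_cst.
  by rewrite integral_cst//= normr1 mul1e; exact: lebesgue_itv_lty.
- apply/aeW => s n _; rewrite lee_fin ger0_norm ?subr_ge0 ?eta_le1//.
  by rewrite gerBl eta_ge0.
- by rewrite integral0 => h; exact: fine_cvg h.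
Qed.

Definition in_young (s : R) (z : R * R) : R := (z.2 < s)%R%:R.

Lemma cvg_eta_young s z : (fun n => eta n (s - z.2)) @ \oo --> in_young s z.
Proof.
rewrite /in_young; have [zs|sz] := ltP z.2 s.
  by apply: cvg_eta; rewrite subr_gt0.
under eq_fun do rewrite eta_le0 ?subr_le0//.
exact: cvg_cst.
Qed.

Lemma eta_le_young n s z : eta n (s - z.2) <= in_young s z.
Proof.
rewrite /in_young; have [zs|sz] := ltP z.2 s; first exact: eta_le1.
by rewrite eta_le0 ?subr_le0.
Qed.

Lemma measurable_in_young s : measurable_fun Q (in_young s : plane R -> R).
Proof.
apply: (measurable_fun_cvg (h := fun n (z : plane R) => eta n (s - z.2))).
- move=> n; apply: measurable_continuous_age.
  exact: (C1_pair_continuous (@C1_pair_eta R n)).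
- by move=> z _; exact: cvg_eta_young.
Qed.

(* [age_comparison] for the difference of two profiles [eta]: the mass with
   [0 < t - y] of order at most [1 / n] consists of recent arrivals only,
   uniformly in [t]; this makes the restricted path cadlag. *)
Lemma boundary_layer_bound (T t : R) n : 0 <= t <= T ->
  (bracket (fun z => in_young t z - eta n (t - z.2))%R (mu t) <=
   (boundary_layer T n)%:E)%E.
Proof.
move=> /andP[t0 tT].
have ce k := C1_pair_continuous (@C1_pair_eta R k).
(* The comparison needs a C^1 profile, so the indicator is approached by [eta (k + n)]; the index is
   at least n, which keeps the difference nonnegative. *)
apply: (cvge_to_le (a := \oo)
  (f := fun k => bracket (fun z => eta (k + n) (t - z.2) - eta n (t - z.2))%R (mu t))).
  apply: (@cvg_bracket _ _ _ _ 1) => [k|k z _|z _].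
  - by apply: measurable_funB; apply: measurable_continuous_age; exact: ce.
  - rewrite ler_norml; apply/andP; split.
      have h1 := eta_ge0 (k + n) (t - z.2); have h2 := eta_le1 n (t - z.2).
      by lra.
    by rewrite (le_trans _ (eta_le1 (k + n) (t - z.2)))// gerBl eta_ge0.
  - apply: cvgB; last exact: cvg_cst.
    by have := @cvg_eta_young t z; rewrite -(cvg_shiftn n).
apply: nearW => k.
have Cd : C1_pair (fun u : R => eta (k + n) u - eta n u)
    (fun u : R => eta' (k + n) u - eta' n u).
  have [d1 c1] := @C1_pair_eta R (k + n); have [d2 c2] := @C1_pair_eta R n.
  split => u; first exact: is_deriveB.
  by apply: cvgB; [exact: c1|exact: c2].
have d01 u : 0 <= eta (k + n) u - eta n u <= (1 : R).
  apply/andP; split; last first.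
    by rewrite (le_trans _ (eta_le1 (k + n) u))// gerBl eta_ge0.
  rewrite subr_ge0; have [u0|u0] := leP 0 u; first by rewrite eta_homo// leq_addl.
  by rewrite !eta_le0 ?lexx// ltW.
have := age_comparison Cd d01 t0.
(* Initially 0 - y <= 0, where both profiles vanish: the initial mass contributes nothing and only
   arrivals are left in the bound. *)
rewrite (@bracket_eq _ (mu 0) _ (fun=> 0)); last first.
  by move=> z /quadrantP[_ z2]; rewrite !eta_le0 ?subrr// sub0r oppr_le0.
rewrite bracket_cst mul0e add0e => /le_trans; apply.
rewrite boundary_layerE; apply: lee_wpmul2l; first by rewrite lee_fin.
have mk (A : set R) : measurable_fun (A : set (measurableTypeR R))
    (fun s => (eta (k + n) s - eta n s)%:E).
  apply/measurable_EFinP; apply: measurable_funTS; apply: continuous_measurable_fun.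
  exact: (C1_pair_continuous Cd).
rewrite -integral_itv_obnd_cbnd; last exact: mk.
apply: (@le_trans _ _ (\int[leb]_(s in J t) (1 - eta n s)%:E)%E).
  apply: ge0_le_integral => //.
  - by move=> s _; rewrite lee_fin; have /andP[] := d01 s.
  - by apply/measurable_EFinP; exact: measurable_one_sub_eta.
  - by move=> s _; rewrite lee_fin lerD2r eta_le1.
apply: ge0_subset_integral => //.
- by apply/measurable_EFinP; exact: measurable_one_sub_eta.
- by move=> s _; rewrite lee_fin subr_ge0 eta_le1.
- by move=> s /=; rewrite !in_itv/= => /andP[-> st]; exact: le_trans tT.
Qed.

(** A mass bound uniform over [0, t], as required to treat the path as a finite kernel. *)
Definition mass_cap (t : R) : R := fine (mu 0 setT) + lambda0 * t.

Lemma mass_capP t s : 0 <= s <= t -> (mu s setT <= (mass_cap t)%:E)%E.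
Proof.
move=> /andP[s0 st]; apply: (le_trans (mass_bound s0)).
rewrite /mass_cap EFinD fineK; last exact: mf_fin_num.
by rewrite leeD2lE ?mf_fin_num// lee_fin ler_wpM2l.
Qed.

Let mu_cadlag : cadlag mu := mu_solution.1.

Local Notation D t := (I t `*` Q : set (timespace R)).

(** * Joint measurability on a bounded time interval and the equation restricted to y < s *)

Section fixed_horizon.
Variable t : R.
Hypothesis t0 : 0 <= t.

Let cap := @mass_capP t.

Lemma time_domain_octant : D t `<=` octant.
Proof.
move=> [s z] [] /=; rewrite in_itv/= => /andP[s0 _] qz.
by split => //; apply/RplusP.
Qed.

Lemma measurable_octant_domain (F : R * (R * R) -> R) :
  {within octant, continuous F} -> measurable_fun (D t) (F : timespace R -> R).
Proof.
move=> cF; apply: measurable_funS (octant_continuous_measurable cF).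
  exact: measurable_octant.
exact: time_domain_octant.
Qed.

Lemma measurable_snd_domain (f : R * R -> R) :
  measurable_fun Q (f : plane R -> R) ->
  measurable_fun (D t) ((fun p => f p.2) : timespace R -> R).
Proof.
move=> mf; apply: (measurable_comp (g := snd) (@measurable_quadrant R) _ mf).
  by move=> _ [p [_ qp] <-].
by apply: measurable_funTS; exact: measurable_snd.
Qed.

Lemma measurable_in_young_domain :
  measurable_fun (D t) ((fun p => in_young p.1 p.2) : timespace R -> R).
Proof.
apply: (measurable_fun_cvg (h := fun n (p : timespace R) => eta n (age p))).
- move=> n; apply: measurable_octant_domain; apply: continuous_subspaceT => p.
  apply: continuous_comp; first exact: continuous_age.
  exact: (C1_pair_continuous (@C1_pair_eta R n)).
- by move=> p _; exact: cvg_eta_young.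
Qed.

(** The condition y <= [ystar (mu s)] is a countable intersection over rationals q. Each set is the
    union of a condition on the strip mass at time s, measurable in s, and the half space y <= q. *)
Lemma measurable_rbar_domain :
  measurable_fun (D t) ((fun p => rbar (mu p.1) p.2.2) : timespace R -> R).
Proof.
pose E (q : rat) : set (timespace R) := [set p | 0 <= (ratr q : R) ->
  (1 <= mu (clamp t p.1) (Rplus `*` `[0%R, ratr q]))%E -> p.2.2 <= ratr q].
have mE q : measurable (E q).
  have [q0|q0] := leP 0 (ratr q : R); last first.
    rewrite (_ : E q = setT) //; apply/seteqP; split => // p _.
    by rewrite /E/= leNgt q0.
  pose S : set (measurableTypeR R) :=
    [set s | (1 <= mu (clamp t s) (Rplus `*` `[0%R, ratr q]))%E].
  have mS : measurable S.
    have ms := measurable_clamp_set mu_cadlag t0 (measurable_strip (ratr q)).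
    rewrite (_ : S = setT `&` (fun s => mu (clamp t s) (Rplus `*` `[0%R, ratr q]))
        @^-1` `[1%E, +oo[%classic).
      by apply: ms => //; exact: emeasurable_itv.
    apply/seteqP; split => s; rewrite /S/= in_itv/= andbT => //.
    by move=> [].
  rewrite (_ : E q = (~` (fst @^-1` S)) `|` ((snd \o snd) @^-1` `]-oo, ratr q])).
    apply: measurableU.
      apply: measurableC; rewrite -[X in measurable X]setTI.
      by apply: measurable_fst.
    rewrite -[X in measurable X]setTI.
    have m2 : measurable_fun setT (snd \o snd : timespace R -> measurableTypeR R).
      by apply: measurableT_comp; [exact: measurable_snd|exact: measurable_snd].
    by apply: m2 => //; exact: measurable_itv.
  apply/seteqP; split => [p Ep|p [h|h]] /=.
  - have [Sp|nSp] := pselect (S p.1); last by left.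
    by right; rewrite /= in_itv/=; exact: Ep.
  - by move=> _ h1; exfalso; exact: h.
  - by move=> _ _; move: h; rewrite /= in_itv.
have mcap : measurable (\bigcap_q E q).
  rewrite -[X in measurable X]setCK setC_bigcap; apply: measurableC.
  by apply: bigcupT_measurable_rat => q; exact: measurableC.
apply: (eq_measurable_fun (\1_(\bigcap_q E q) : timespace R -> R)); last first.
  by apply: measurable_funTS; exact: measurable_indic.
move=> p /set_mem [pI pQ]; rewrite indicE /rbar; congr (nat_of_bool _)%:R.
have pc : clamp t p.1 = p.1 by apply: clamp_id; move: pI; rewrite /= in_itv.
apply/idP/idP => [/set_mem h|/le_ystar_ratP h].
- apply/le_ystar_ratP => q q0 hq; have := h q Logic.I q0.
  by rewrite pc; exact.
- by apply/mem_set => q _ q0; rewrite pc; exact: h.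
Qed.

Lemma measurable_hazard_domain :
  measurable_fun (D t) ((fun p => hazard g (mu p.1) p.2) : timespace R -> R).
Proof.
apply: measurable_funD; last by apply: measurable_snd_domain; exact: measurable_hgy.
apply: measurable_funM; first exact: measurable_rbar_domain.
by apply: measurable_snd_domain; exact: measurable_hgx.
Qed.

Lemma measurable_transport_domain phi : C1c_octant phi ->
  measurable_fun (D t) ((fun p => transport (mu p.1) phi p.1 p.2) : timespace R -> R).
Proof.
move=> [_ _ [ct cx cy] _].
apply: (eq_measurable_fun (fun p : timespace R =>
    phi_t phi p + rbar (mu p.1) p.2.2 * phi_x phi p + phi_y phi p)).
  by move=> [s z] _.
apply: measurable_funD; last exact: measurable_octant_domain.
apply: measurable_funD; first exact: measurable_octant_domain.
by apply: measurable_funM; [exact: measurable_rbar_domain|exact: measurable_octant_domain].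
Qed.

Local Notation TB := (time_bracket mu t).

Lemma bracketZl (m : MFplus R) (C : R) (f : R * R -> R) : 0 <= C ->
  measurable_fun Q (f : plane R -> R) -> (forall z, Q z -> 0 <= f z) ->
  bracket (fun z => C * f z) m = (C%:E * bracket f m)%E.
Proof.
move=> C0 mf f0; rewrite /bracket -ge0_integralZl_EFin//.
- exact: measurable_quadrant.
- exact/measurable_EFinP.
Qed.

Lemma time_bracket_hazard_lty (C : R) : 0 <= C ->
  (TB (fun p => C * hazard g (mu p.1) p.2)%R < +oo)%E.
Proof.
move=> C0; have mh := measurable_hazard_domain.
rewrite (_ : TB _ =
    \int[leb]_(s in I t) (C%:E * bracket (hazard g (mu s)) (mu s)))%E; last first.
  apply: eq_integral => s /set_mem/=; rewrite in_itv/= => sI; apply: bracketZl => //.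
    exact: (measurable_section sI mh).
  by move=> z qz; exact: hazard_ge0.
rewrite ge0_integralZl_EFin//.
- have [_ [_ _ h _]] := mu_solution; apply: lte_mul_pinfty => //.
  exact: h.
- by move=> s _; apply: bracket_ge0 => z; exact: hazard_ge0.
- exact: (measurable_bracket mu_cadlag t0 cap mh).
Qed.

Lemma time_bracket_cst_lty (C : R) : 0 <= C -> (TB (fun=> C) < +oo)%E.
Proof.
move=> C0; have cap0 : 0 <= mass_cap t.
  rewrite /mass_cap addr_ge0 ?mulr_ge0//; apply: fine_ge0; exact: measure_ge0.
apply: (@le_lt_trans _ _ (\int[leb]_(s in I t) (C * mass_cap t)%:E)%E).
  apply: ge0_le_integral => //.
  - by move=> s _; apply: bracket_ge0.
  - by apply: (measurable_bracket mu_cadlag t0 cap); exact: measurable_cst.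
  - move=> s /=; rewrite in_itv/= => sI.
    by rewrite bracket_cst EFinM lee_wpmul2l// cap.
rewrite integral_cst//= lte_mul_pinfty// ?lee_fin ?mulr_ge0//.
by rewrite lebesgue_measure_itv/=; case: ifP => // _; rewrite ltry.
Qed.

Lemma dominatedM H F w : dominated t H F ->
  measurable_fun (D t) (w : timespace R -> R) -> (forall p, D t p -> `|w p| <= 1) ->
  dominated t H (fun p => F p * w p).
Proof.
move=> [mF FH] mw w1; split; first exact: measurable_funM.
by move=> p Dp; rewrite normrM (le_trans _ (FH p Dp))// ler_piMr// w1.
Qed.

Lemma dominated_hazard phi (C : R) : C1c_octant phi ->
  (forall p, octant p -> `|phi p| <= C) ->
  dominated t (fun p => C * hazard g (mu p.1) p.2)
    (fun p => phi p * hazard g (mu p.1) p.2).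
Proof.
move=> [cphi _ _ _] hC; split.
  by apply: measurable_funM; [exact: measurable_octant_domain|exact: measurable_hazard_domain].
move=> p Dp; have op := time_domain_octant Dp.
have h0 : 0 <= hazard g (mu p.1) p.2 by apply: hazard_ge0 => //; case: Dp.
by rewrite normrM (ger0_norm h0) ler_wpM2r// hC.
Qed.

Lemma dominated_transport phi (C : R) : C1c_octant phi ->
  (forall m s z, octant (s, z) -> `|transport m phi s z| <= C) ->
  dominated t (fun=> C) (fun p => transport (mu p.1) phi p.1 p.2).
Proof.
move=> Cphi hC; split; first exact: measurable_transport_domain.
by move=> [s z] Dp; apply: hC; exact: (time_domain_octant Dp).
Qed.

Lemma norm_eta_le1 n u : `|eta n u| <= (1 : R).
Proof. by rewrite ger0_norm ?eta_ge0 ?eta_le1. Qed.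

Lemma norm_in_young_le1 s z : `|in_young s z| <= 1.
Proof. by rewrite /in_young; case: ltP => _; rewrite ?normr1 ?normr0. Qed.

Lemma measurable_eta_age n :
  measurable_fun (D t) ((fun p => eta n (age p)) : timespace R -> R).
Proof.
apply: measurable_octant_domain; apply: continuous_subspaceT => p.
apply: continuous_comp; first exact: continuous_age.
exact: (C1_pair_continuous (@C1_pair_eta R n)).
Qed.

Lemma cvg_time_bracket_young H F : measurable_fun (D t) (H : timespace R -> R) ->
  (TB H < +oo)%E -> dominated t H F ->
  (fun n => TB (fun p => F p * eta n (age p))) @ \oo -->
  TB (fun p => F p * in_young p.1 p.2).
Proof.
move=> mH Hfin dF; apply: (cvg_time_bracket mu_cadlag t0 cap mH Hfin).
- move=> n; apply: dominatedM => //; first exact: measurable_eta_age.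
  by move=> p _; exact: norm_eta_le1.
- move=> p Dp; apply: cvgM; first exact: cvg_cst.
  exact: cvg_eta_young.
Qed.

(* [eta n (s - y)] is constant along the transport in time and age and tends
   to the indicator of [y < s]; letting [n] grow in the equation for
   [phi * eta n (s - y)] gives the equation restricted to [y < s]. *)
Lemma young_dynamics phi : C1c_octant phi ->
  (bracket (fun z => phi (t, z) * in_young t z)%R (mu t) =
   lambda0%:E * \int[leb]_(s in I t) (phi (s, (0%R, 0%R)))%:E
   - TB (fun p => phi p * hazard g (mu p.1) p.2 * in_young p.1 p.2)%R
   + TB (fun p => transport (mu p.1) phi p.1 p.2 * in_young p.1 p.2)%R)%E.
Proof.
move=> Cphi; have [C C0 hC] := test_bounded Cphi.
have [B B0 hB] := transport_bounded Cphi.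
have mh := measurable_hazard_domain.
have mCh : measurable_fun (D t)
    ((fun p => C * hazard g (mu p.1) p.2) : timespace R -> R).
  by apply: measurable_funM => //; exact: measurable_cst.
have dh := dominated_hazard Cphi hC; have dt := dominated_transport Cphi hB.
have hfin := time_bracket_hazard_lty C0; have tfin := time_bracket_cst_lty B0.
have mB : measurable_fun (D t) ((fun=> B) : timespace R -> R) by exact: measurable_cst.
have ch := cvg_time_bracket_young mCh hfin dh.
have ct := cvg_time_bracket_young mB tfin dt.
have myd : measurable_fun (D t) ((fun p => in_young p.1 p.2) : timespace R -> R).
  exact: measurable_in_young_domain.
have ny1 p : D t p -> `|in_young p.1 p.2| <= 1 by move=> _; exact: norm_in_young_le1.
have fh := time_bracket_fin_num mu_cadlag t0 cap mCh hfin (dominatedM dh myd ny1).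
have ft := time_bracket_fin_num mu_cadlag t0 cap mB tfin (dominatedM dt myd ny1).
have mphit : measurable_fun Q ((fun z => phi (t, z)) : plane R -> R).
  apply: (@measurable_section _ t phi t); first by rewrite t0 lexx.
  by apply: measurable_octant_domain; case: Cphi.
have cl : (fun n => bracket (fun z => phi (t, z) * eta n (t - z.2)) (mu t)) @ \oo -->
    bracket (fun z => phi (t, z) * in_young t z) (mu t).
  apply: (@cvg_bracket _ _ _ _ C) => [n|n z qz|z qz].
  - apply: measurable_funM => //; apply: measurable_continuous_age.
    exact: (C1_pair_continuous (@C1_pair_eta R n)).
  - have o : octant (t, z) by split => //; apply/RplusP.
    by rewrite normrM (le_trans _ (hC _ o))// ler_piMr// norm_eta_le1.
  - by apply: cvgM; [exact: cvg_cst|exact: cvg_eta_young].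
have mphi00 : measurable_fun (I t) ((fun s => phi (s, (0, 0))) : measurableTypeR R -> R).
  have [c _ _ _] := Cphi.
  apply: (measurable_comp (g := fun s : measurableTypeR R => ((s, (0, 0)) : timespace R))
        (@measurable_octant R) _ (octant_continuous_measurable c)).
  - by move=> _ [s /= + <-]; rewrite in_itv/= => /andP[s0 _]; apply/octantP.
  - by apply: measurable_funTS; apply: measurable_fun_pair.
have JI : J t `<=` I t by move=> s /=; rewrite !in_itv/= => /andP[/ltW -> ->].
have mphiJ : measurable_fun (J t) ((fun s => phi (s, (0, 0))) : measurableTypeR R -> R).
  by apply: measurable_funS mphi00 => //; exact: measurable_itv.
have meJ n : measurable_fun (J t) (fun s => (phi (s, (0, 0)) * eta n (s - 0))%:E).
  apply/measurable_EFinP; apply: measurable_funM => //.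
  apply: measurable_funTS; apply: continuous_measurable_fun => s.
  under eq_fun do rewrite subr0.
  exact: (C1_pair_continuous (@C1_pair_eta R n)).
have mJ : measurable (J t) by exact: measurable_itv.
have phi00C s : J t s -> `|phi (s, (0, 0))| <= C.
  by rewrite /= in_itv/= => /andP[/ltW s0 _]; apply: hC; apply/octantP.
have icst : leb.-integrable (J t) (fun=> C%:E).
  apply/integrableP; split; first exact: measurable_cst.
  rewrite integral_cst//= lte_mul_pinfty// ?lee_fin//.
  exact: lebesgue_itv_lty.
have [iphi ca] : leb.-integrable (J t) (fun s => (phi (s, (0, 0)))%:E) /\
    (fun n => \int[leb]_(s in J t) (phi (s, (0%R, 0%R)) * eta n (s - 0)%R)%:E)%E @ \oo
    --> (\int[leb]_(s in J t) (phi (s, (0%R, 0%R)))%:E)%E.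
  have [|||||? _ ?//] := @dominated_convergence _ _ _ leb _ mJ
    (fun n s => (phi (s, (0, 0)) * eta n (s - 0))%:E)
    (fun s => (phi (s, (0, 0)))%:E) (fun=> C%:E).
  - exact: meJ.
  - exact/measurable_EFinP.
  - apply/aeW => s /=; rewrite in_itv/= => /andP[s0 _].
    apply: cvg_EFin; first exact: nearW.
    rewrite -[X in _ --> X]mulr1; apply: cvgM; first exact: cvg_cst.
    by rewrite subr0; exact: cvg_eta.
  - exact: icst.
  - apply/aeW => s n sJ; rewrite lee_fin normrM (le_trans _ (phi00C s sJ))//.
    by rewrite ler_piMr// norm_eta_le1.
have fa := integrable_fin_num mJ iphi.
(* The initial term disappears because the profile vanishes at 0 - y <= 0. The source sits at y = 0,
   where the profile is [eta n s]; removing the null point s = 0 prepares its limit. *)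
have eqn n : (bracket (fun z => phi (t, z) * eta n (t - z.2))%R (mu t) =
    lambda0%:E * \int[leb]_(s in J t) (phi (s, (0%R, 0%R)) * eta n (s - 0)%R)%:E
    - TB (fun p => phi p * hazard g (mu p.1) p.2 * eta n (age p))%R
    + TB (fun p => transport (mu p.1) phi p.1 p.2 * eta n (age p))%R)%E.
  have Ce := @C1_pair_eta R n.
  rewrite (solution_dynamics t0 (C1c_mul_age Cphi Ce)).
  rewrite (@bracket_eq _ (mu 0) _ (fun=> 0)); last first.
    move=> z /quadrantP[_ z2]; rewrite /age/= eta_le0 ?mulr0//.
    by rewrite sub0r oppr_le0.
  rewrite bracket_cst mul0e add0e integral_itv_obnd_cbnd; last exact: meJ.
  have eA : (\int[leb]_(s in I t)
      bracket (fun z => phi (s, z) * eta n (age (s, z)) * hazard g (mu s) z)%R (mu s) =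
      TB (fun p => phi p * hazard g (mu p.1) p.2 * eta n (age p))%R)%E.
    apply: eq_integral => s _; apply: bracket_eq => z qz.
    by rewrite /= mulrAC.
  have eB : (\int[leb]_(s in I t)
      bracket (transport (mu s) (fun p => phi p * eta n (age p))%R s) (mu s) =
      TB (fun p => transport (mu p.1) phi p.1 p.2 * eta n (age p))%R)%E.
    apply: eq_integral => s /set_mem/=; rewrite in_itv/= => /andP[s0 _].
    apply: bracket_eq => z qz.
    have o : octant (s, z) := conj ((RplusP s).2 s0) qz.
    exact: (transport_mul_age (mu s) Cphi Ce o).
  by rewrite eA eB.
have := cl; under eq_fun do rewrite eqn.
move=> cl'; rewrite -(integral_itv_obnd_cbnd (r := 0)); last exact/measurable_EFinP.
(* Both sides converge; finiteness of the loss and transport limits, [fh] and [ft], rules out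
   indeterminate sums. *)
exact: (cvg_unique (@ereal_hausdorff R) cl'
  (cvg_balance (c := lambda0) ca ch ct fh ft)).
Qed.

End fixed_horizon.

(** * The young part as a solution started from zero mass, and the old part by subtraction *)

Lemma restr_eq0 (m : MFplus R) (A B : set (plane R)) (mA : measurable A) :
  measurable B -> m B = 0%E -> restr m mA B = 0%E.
Proof.
move=> mB B0; apply/eqP; rewrite eq_le measure_ge0 andbT -B0 restrE.
by apply: le_measure; rewrite ?inE//; exact: measurableI.
Qed.

Lemma restr_ymarginal_ac (m : MFplus R) (A : set (plane R)) (mA : measurable A) :
  ymarginal_ac m -> ymarginal_ac (restr m mA).
Proof.
move=> ac N /ac mN B mB BN; apply: restr_eq0; last exact: mN.
by apply: measurableX => //; exact: measurable_Rplus.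
Qed.

Lemma indic_young s z : \1_(young s) z = in_young s z :> R.
Proof.
rewrite indicE /in_young; congr (nat_of_bool _)%:R.
by apply/idP/idP => [/set_mem|h]; [|exact/mem_set].
Qed.

Lemma bracket_young m s (f : R * R -> R) : measurable_fun Q (f : plane R -> R) ->
  bracket f (young_part m s) = bracket (fun z => f z * in_young s z) m.
Proof.
by move=> mf; rewrite bracket_restr//; apply: bracket_eq => z _; rewrite indic_young.
Qed.

Lemma bracket_old m s (f : R * R -> R) : measurable_fun Q (f : plane R -> R) ->
  bracket f (old_part m s) = bracket (fun z => f z * (1 - in_young s z)) m.
Proof.
move=> mf; rewrite bracket_restr//; apply: bracket_eq => z _.
by rewrite -indic_young !indicE in_setC; case: (_ \in _); rewrite ?subr0 ?subrr.
Qed.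

(** The two integrands may differ where y >= s. This is what allows the hazard and transport of the
    young part to be replaced by those of the full measure, which agree with them only for y < s. *)
Lemma bracket_young_eq m s (f h : R * R -> R) :
  measurable_fun Q (f : plane R -> R) -> (forall z, Q z -> z.2 < s -> f z = h z) ->
  bracket f (young_part m s) = bracket (fun z => h z * in_young s z) m.
Proof.
move=> mf fh; rewrite bracket_young//; apply: bracket_eq => z qz.
by rewrite /in_young; case: ltP => zs; rewrite ?mulr0// fh.
Qed.

Lemma measurable_hazard m : measurable_fun Q (hazard g m : plane R -> R).
Proof.
apply: measurable_funD; last exact: measurable_hgy.
by apply: measurable_funM; [exact: measurable_rbar|exact: measurable_hgx].
Qed.

Lemma measurable_octant_section (F : R * (R * R) -> R) s : 0 <= s ->
  {within octant, continuous F} ->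
  measurable_fun Q ((fun z => F (s, z)) : plane R -> R).
Proof.
move=> s0 cF; apply: (@measurable_section _ s F s); first by rewrite s0 lexx.
exact: measurable_octant_domain.
Qed.

Lemma measurable_transport m phi s : 0 <= s -> C1c_octant phi ->
  measurable_fun Q (transport m phi s : plane R -> R).
Proof.
move=> s0 [_ _ [ct cx cy] _].
apply: measurable_funD; last exact: measurable_octant_section.
apply: measurable_funD; first exact: measurable_octant_section.
by apply: measurable_funM; [exact: measurable_rbar|exact: measurable_octant_section].
Qed.

Lemma bounded_bracket_fin_num m (f : R * R -> R) (C : R) :
  measurable_fun Q (f : plane R -> R) -> (forall z, Q z -> `|f z| <= C) ->
  bracket f m \is a fin_num.
Proof.
move=> mf fC; apply: integrable_fin_num; first exact: measurable_quadrant.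
exact: bounded_bracket_integrable fC.
Qed.

Lemma fine_bracket_dist m (f1 f2 h : R * R -> R) (C B : R) :
  measurable_fun Q (f1 : plane R -> R) -> measurable_fun Q (f2 : plane R -> R) ->
  measurable_fun Q (h : plane R -> R) ->
  (forall z, Q z -> `|f1 z| <= C) -> (forall z, Q z -> `|f2 z| <= C) ->
  (forall z, Q z -> `|f1 z - f2 z| <= h z) -> (bracket h m <= B%:E)%E ->
  `|fine (bracket f1 m) - fine (bracket f2 m)| <= B.
Proof.
move=> m1 m2 mh b1 b2 hh hB; have mQ := @measurable_quadrant R.
have F1 := bounded_bracket_fin_num m m1 b1.
have F2 := bounded_bracket_fin_num m m2 b2.
have i1 := bounded_bracket_integrable m m1 b1.
have i2 := bounded_bracket_integrable m m2 b2.
have E : (fine (bracket f1 m) - fine (bracket f2 m))%:E =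
    bracket (fun z => f1 z - f2 z) m.
  by rewrite EFinB !fineK// /bracket -integralB_EFin.
rewrite -lee_fin (le_trans _ hB)//.
change (`|(fine (bracket f1 m) - fine (bracket f2 m))%:E| <= bracket h m)%E.
rewrite {}E.
apply: le_trans; first apply: le_abse_integral => //.
  by apply/measurable_EFinP; exact: measurable_funB.
apply: ge0_le_integral => //.
- apply/measurable_EFinP; apply: measurableT_comp => //.
  exact: measurable_funB.
- exact/measurable_EFinP.
Qed.

(** A general filter covers right limits, where m is [mu t], and left limits, where m is another
    measure. The indicator of y < s is discontinuous and moves with s, so the error is split in
    four: indicator to profile under m, weak convergence with the profile frozen at t, a Lipschitz
    shift from t to s, and profile back to indicator under [mu s]. *)
Lemma young_weak_cvg (T t : R) (F : set_system R) (m : MFplus R) :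
  ProperFilter F -> (\forall s \near F, 0 <= s <= T) -> (fun s => s) @ F --> t ->
  weak_cvg F mu m ->
  weak_cvg F (fun s => young_part (mu s) s) (young_part m t).
Proof.
move=> FF FT Ft cm f cf bf; have mf := quadrant_continuous_measurable cf.
have [C [C0 fC]] : exists C, 0 < C /\ forall z, Q z -> `|f z| <= C.
  have [C [_ hC]] := bf; exists (`|C| + 1); split; first by rewrite ltr_wpDl.
  by move=> z qz; apply: (hC (`|C| + 1)) => //; rewrite (le_lt_trans (ler_norm C))// ltrDl.
have ce n := C1_pair_continuous (@C1_pair_eta R n).
rewrite bracket_young//; under eq_fun do rewrite bracket_young//.
have myf s : measurable_fun Q ((fun z => f z * in_young s z) : plane R -> R).
  by apply: measurable_funM => //; exact: measurable_in_young.
have mef n s : measurable_fun Q ((fun z => f z * eta n (s - z.2)) : plane R -> R).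
  by apply: measurable_funM => //; exact: measurable_continuous_age.
have byf s z : Q z -> `|f z * in_young s z| <= C.
  by move=> qz; rewrite normrM (le_trans _ (fC z qz))// ler_piMr// norm_in_young_le1.
have bef n s z : Q z -> `|f z * eta n (s - z.2)| <= C.
  by move=> qz; rewrite normrM (le_trans _ (fC z qz))// ler_piMr// norm_eta_le1.
have fy s m' := bounded_bracket_fin_num m' (myf s) (byf s).
have fe n s m' := bounded_bracket_fin_num m' (mef n s) (bef n s).
rewrite -(fineK (fy t m)); apply: cvg_EFin.
  by apply: nearW => s; exact: fy.
apply/cvgrPdist_le => e e0; have e4 : 0 < e / 4 by rewrite divr_gt0.
have c1 : (fun n => fine (bracket (fun z => f z * eta n (t - z.2)) m)) @ \oo -->
    fine (bracket (fun z => f z * in_young t z) m).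
  apply: fine_cvg; rewrite fineK//; apply: (@cvg_bracket _ _ _ _ C) => //.
  - by move=> n z qz; exact: bef.
  - by move=> z qz; apply: cvgM; [exact: cvg_cst|exact: cvg_eta_young].
have c2 : (fun n => C * boundary_layer T n) @ \oo --> (0 : R).
  by rewrite -(mulr0 C); apply: cvgM; [exact: cvg_cst|exact: cvg_boundary_layer].
(* n is fixed before s: the boundary layer bound is uniform over [0, T], so the same profile serves
   all s near the limit. *)
have [n [n1 n2]] : exists n,
    `|fine (bracket (fun z => f z * in_young t z) m)
      - fine (bracket (fun z => f z * eta n (t - z.2)) m)| <= e / 4 /\
    C * boundary_layer T n <= e / 4.
  near \oo => n; exists n; split; near: n.
    by move/cvgrPdist_le : c1; apply.
  by apply: (cvgr_le _ c2).
have c3 : (fun s => fine (bracket (fun z => f z * eta n (t - z.2)) (mu s))) @ F -->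
    fine (bracket (fun z => f z * eta n (t - z.2)) m).
  apply: fine_cvg; rewrite fineK//; apply: cm; last first.
    exists C; split; first exact: num_real.
    by move=> M CM z qz /=; rewrite (le_trans (bef n t z qz))// ltW.
  apply: within_continuousM => //; apply: continuous_subspaceT => z.
  apply: (@continuous_comp _ _ _ (fun z : R * R => t - z.2) (eta n)); last exact: ce.
  by apply: cvgB; [exact: cvg_cst|exact: cvg_snd].
have c4 : (fun s => C * (n%:R * `|s - t|) * mass_cap T) @ F --> (0 : R).
  rewrite [X in _ --> X](_ : _ = C * (n%:R * `|t - t|) * mass_cap T); last first.
    by rewrite subrr normr0 !mulr0 mul0r.
  apply: cvgM; last exact: cvg_cst.
  apply: cvgM; first exact: cvg_cst.
  apply: cvgM; first exact: cvg_cst.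
  by apply: cvg_norm; apply: cvgB; [exact: Ft|exact: cvg_cst].
near=> s.
have sT : 0 <= s <= T by near: s.
have h1 : `|fine (bracket (fun z => f z * eta n (t - z.2)) m)
    - fine (bracket (fun z => f z * eta n (t - z.2)) (mu s))| <= e / 4.
  by near: s; move/cvgrPdist_le : c3; apply.
have h2 : `|fine (bracket (fun z => f z * eta n (t - z.2)) (mu s))
    - fine (bracket (fun z => f z * eta n (s - z.2)) (mu s))| <= e / 4.
  apply: (@fine_bracket_dist _ _ _ (fun=> C * (n%:R * `|s - t|)) C) => //.
  - exact: bef.
  - exact: bef.
  - move=> z qz; rewrite -mulrBr normrM ler_pM// ?fC//.
    by rewrite (le_trans (eta_lip _ _ _))// opprB addrA subrK distrC.
  - rewrite bracket_cst (@le_trans _ _ ((C * (n%:R * `|s - t|))%:E * (mass_cap T)%:E)%E)//.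
      by apply: lee_wpmul2l; [rewrite lee_fin !mulr_ge0// ltW|exact: mass_capP].
    rewrite -EFinM lee_fin; near: s.
    by apply: (cvgr_le _ c4).
have h3 : `|fine (bracket (fun z => f z * eta n (s - z.2)) (mu s))
    - fine (bracket (fun z => f z * in_young s z) (mu s))| <= e / 4.
  apply: (@fine_bracket_dist _ _ _ (fun z => C * (in_young s z - eta n (s - z.2))) C) => //.
  - apply: measurable_funM => //; apply: measurable_funB.
      exact: measurable_in_young.
    exact: measurable_continuous_age.
  - exact: bef.
  - exact: byf.
  - move=> z qz; rewrite -mulrBr normrM ler_pM// ?fC//.
    by rewrite distrC ger0_norm// subr_ge0 eta_le_young.
  - rewrite bracketZl; [|exact: ltW| |].
    + rewrite (@le_trans _ _ (C%:E * (boundary_layer T n)%:E)%E)//.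
        by apply: lee_wpmul2l; [rewrite lee_fin ltW|exact: boundary_layer_bound].
    + apply: measurable_funB; first exact: measurable_in_young.
      exact: measurable_continuous_age.
    + by move=> z qz; rewrite subr_ge0 eta_le_young.
exact: (ler_dist4 n1 h1 h2 h3).
Unshelve. all: by end_near. Qed.

Lemma young_cadlag : cadlag (fun s => young_part (mu s) s).
Proof.
split => t t0.
- apply: (@young_weak_cvg (t + 1)); last exact: mu_cadlag.1.
  + near=> s; apply/andP; split.
      by rewrite (le_trans t0)// ltW//; near: s; exact: nbhs_right_gt.
    by apply: ltW; near: s; apply: nbhs_right_lt; rewrite ltrDl.
  + by apply: cvg_within.
- have [m cm] := mu_cadlag.2 t t0; exists (young_part m t).
  apply: (@young_weak_cvg t) cm.
  + near=> s; apply/andP; split.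
      by apply: ltW; near: s; exact: nbhs_left_gt.
    by apply: ltW; near: s; exact: nbhs_left_lt.
  + by apply: cvg_within.
Unshelve. all: by end_near. Qed.

Lemma young_hazard_le s : 0 <= s ->
  (bracket (fun z => hazard g (mu s) z * in_young s z)%R (mu s) <=
   bracket (hazard g (mu s)) (mu s))%E.
Proof.
move=> s0; have mh := measurable_hazard (mu s).
apply: le_bracket => //.
- by apply: measurable_funM => //; exact: measurable_in_young.
- by move=> z qz; rewrite mulr_ge0 ?hazard_ge0// /in_young ler0n.
- move=> z qz; rewrite ler_piMr ?hazard_ge0//.
  by rewrite /in_young; case: ltP.
Qed.

Lemma young_solution : solution lambda0 g (fun s => young_part (mu s) s).
Proof.
have [_ [sa sb sc sd]] := mu_solution.
split; first exact: young_cadlag.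
(* The coefficients of the young part and of [mu] need only agree for y < s, the region carrying the
   young part. *)
have hz s z : quadrant z -> z.2 < s ->
    hazard g (young_part (mu s) s) z = hazard g (mu s) z.
  by move=> _ zs; rewrite /hazard rbar_young.
have tr phi s z : quadrant z -> z.2 < s ->
    transport (young_part (mu s) s) phi s z = transport (mu s) phi s z.
  by move=> _ zs; rewrite /transport rbar_young.
split.
- by move=> t t0; apply: restr_eq0; [exact: measurable_Ugc|exact: sa].
- by move=> t t0; apply: restr_ymarginal_ac; exact: sb.
- move=> t t0; apply: le_lt_trans (sc t t0).
  rewrite [leLHS](_ : _ = \int[leb]_(s in I t)
    bracket (fun z => hazard g (mu s) z * in_young s z)%R (mu s))%E; last first.
    by apply: eq_integral => s _; apply: bracket_young_eq; [exact: measurable_hazard|exact: hz].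
  have cap := @mass_capP t.
  apply: ge0_le_integral => //.
  + move=> s _; apply: bracket_ge0 => z qz.
    by rewrite mulr_ge0 ?hazard_ge0// /in_young ler0n.
  + apply: (measurable_bracket mu_cadlag t0 cap
      (F := fun p => hazard g (mu p.1) p.2 * in_young p.1 p.2)).
    apply: measurable_funM; first exact: measurable_hazard_domain.
    exact: measurable_in_young_domain.
  + apply: (measurable_bracket mu_cadlag t0 cap (F := fun p => hazard g (mu p.1) p.2)).
    exact: measurable_hazard_domain.
  + by move=> s /=; rewrite in_itv/= => /andP[s0 _]; exact: young_hazard_le.
- move=> t phi t0 Cphi; have [cphi _ _ _] := Cphi.
  rewrite !bracket_young; [|exact: measurable_octant_section..].
  have e0 : bracket (fun z => phi (0, z) * in_young 0 z) (mu 0) = 0%E.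
    rewrite (@bracket_eq _ (mu 0) _ (fun=> 0)) ?bracket_cst ?mul0e// => z.
    by move=> /quadrantP[_ z2]; rewrite /in_young ltNge z2/= mulr0.
  have eA : (\int[leb]_(s in I t)
      bracket (fun z => phi (s, z) * hazard g (young_part (mu s) s) z)%R
        (young_part (mu s) s) =
      time_bracket mu t (fun p => phi p * hazard g (mu p.1) p.2 * in_young p.1 p.2)%R)%E.
    apply: eq_integral => s /set_mem/=; rewrite in_itv/= => /andP[s0 _].
    apply: bracket_young_eq.
      apply: measurable_funM; last exact: measurable_hazard.
      exact: measurable_octant_section.
    by move=> z qz zs; rewrite hz.
  have eB : (\int[leb]_(s in I t)
      bracket (transport (young_part (mu s) s) phi s) (young_part (mu s) s) =
      time_bracket mu t (fun p => transport (mu p.1) phi p.1 p.2 * in_young p.1 p.2)%R)%E.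
    apply: eq_integral => s /set_mem/=; rewrite in_itv/= => /andP[s0 _].
    by apply: bracket_young_eq; [exact: measurable_transport|exact: tr].
  by rewrite e0 add0e eA eB; exact: young_dynamics.
Qed.

(** The half plane y < 0 misses the quadrant. *)
Lemma young_null_at_0 : null_at_0 (fun s => young_part (mu s) s).
Proof.
move=> A mA; apply/eqP; rewrite eq_le measure_ge0 andbT -(mf_carried (mu 0)) restrE.
apply: le_measure; rewrite ?inE.
- by apply: measurableI => //; exact: measurable_young.
- by apply: measurableC; exact: measurable_quadrant.
- by move=> z [_ z0] /quadrantP[_]; rewrite leNgt z0.
Qed.

(** The equation of the young part is subtracted from that of [mu], and the source cancels. The
    coefficients remain those of the full [mu]: old mass does feel the younger mass through
    [rbar (mu s)]. *)
Lemma old_dynamics t phi : 0 <= t -> C1c_octant phi ->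
  (bracket (fun z => phi (t, z)) (old_part (mu t) t) =
   bracket (fun z => phi (0%R, z)) (old_part (mu 0%R) 0%R)
   - \int[leb]_(s in I t)
       bracket (fun z => phi (s, z) * hazard g (mu s) z)%R (old_part (mu s) s)
   + \int[leb]_(s in I t) bracket (transport (mu s) phi s) (old_part (mu s) s))%E.
Proof.
move=> t0 Cphi; have [cphi _ _ _] := Cphi.
have [C C0 hC] := test_bounded Cphi; have [B B0 hB] := transport_bounded Cphi.
have cap := @mass_capP t.
have mCh : measurable_fun (D t)
    ((fun p => C * hazard g (mu p.1) p.2) : timespace R -> R).
  by apply: measurable_funM; [exact: measurable_cst|exact: measurable_hazard_domain].
have mB : measurable_fun (D t) ((fun=> B) : timespace R -> R) by exact: measurable_cst.
have dh := dominated_hazard t0 Cphi hC; have dt := dominated_transport t0 Cphi hB.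
have hfin := time_bracket_hazard_lty t0 C0; have tfin := time_bracket_cst_lty t0 B0.
have my := @measurable_in_young_domain t.
have mo : measurable_fun (D t) ((fun p => 1 - in_young p.1 p.2) : timespace R -> R).
  by apply: measurable_funB => //; exact: measurable_cst.
have y1 p : D t p -> `|in_young p.1 p.2| <= 1 by move=> _; exact: norm_in_young_le1.
have o1 p : D t p -> `|1 - in_young p.1 p.2| <= 1.
  by move=> _; rewrite /in_young; case: ltP => _; rewrite ?subrr ?subr0 ?normr0 ?normr1.
(* Besides splitting a time integral at y = s, this certifies that both pieces are finite, so that
   they can be subtracted. *)
have split_tb H F : measurable_fun (D t) (H : timespace R -> R) ->
    (time_bracket mu t H < +oo)%E -> dominated t H F ->
    [/\ time_bracket mu t F = (time_bracket mu t (fun p => F p * in_young p.1 p.2)%R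
        + time_bracket mu t (fun p => F p * (1 - in_young p.1 p.2))%R)%E,
      time_bracket mu t (fun p => F p * in_young p.1 p.2) \is a fin_num &
      time_bracket mu t (fun p => F p * (1 - in_young p.1 p.2)) \is a fin_num].
  move=> mH Hf dF; have d1 := dominatedM dF my y1; have d2 := dominatedM dF mo o1.
  have FE : (fun p => F p * in_young p.1 p.2 + F p * (1 - in_young p.1 p.2)) = F.
    by apply/funext => p; rewrite -mulrDr addrC subrK mulr1.
  split.
  - rewrite -(time_bracketD mu_cadlag t0 cap mH Hf d1 d2) ?FE//.
  - exact: (time_bracket_fin_num mu_cadlag t0 cap mH Hf d1).
  - exact: (time_bracket_fin_num mu_cadlag t0 cap mH Hf d2).
have [eh fh1 fh2] := split_tb _ _ mCh hfin dh.
have [et ft1 ft2] := split_tb _ _ mB tfin dt.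
have mphi s : 0 <= s -> measurable_fun Q ((fun z => phi (s, z)) : plane R -> R).
  by move=> s0; exact: measurable_octant_section.
have yd := young_dynamics t0 Cphi.
have md := solution_dynamics t0 Cphi.
have bphi s z : 0 <= s -> Q z -> `|phi (s, z)| <= C.
  by move=> s0 qz; apply: hC; split => //; apply/RplusP.
have mw s (w : R -> R) : measurable_fun setT w -> 0 <= s ->
    measurable_fun Q ((fun z => phi (s, z) * w (in_young s z)) : plane R -> R).
  move=> mw s0; apply: measurable_funM; first exact: mphi.
  by apply: measurableT_comp => //; exact: measurable_in_young.
have bw s z (c : R) : 0 <= s -> Q z -> `|c| <= 1 -> `|phi (s, z) * c| <= C.
  by move=> s0 qz c1; rewrite normrM (le_trans _ (bphi s z s0 qz))// ler_piMr.
have m1 := mw t id (@measurable_id _ _ _) t0.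
have m2 : measurable_fun Q ((fun z => phi (t, z) * (1 - in_young t z)) : plane R -> R).
  apply: (mw t (fun u => 1 - u)) => //; apply: measurable_funB => //.
have b1 z : Q z -> `|phi (t, z) * in_young t z| <= C.
  by move=> qz; apply: bw => //; exact: norm_in_young_le1.
have b2 z : Q z -> `|phi (t, z) * (1 - in_young t z)| <= C.
  move=> qz; apply: bw => //.
  by rewrite /in_young; case: ltP => _; rewrite ?subrr ?subr0 ?normr0 ?normr1.
have f1 := bounded_bracket_fin_num (mu t) m1 b1.
have f2 := bounded_bracket_fin_num (mu t) m2 b2.
have f0 := bounded_bracket_fin_num (mu 0) (mphi 0 (lexx 0)) (fun z => bphi 0 z (lexx 0)).
have ebt : bracket (fun z => phi (t, z)) (mu t) =
    (bracket (fun z => phi (t, z) * in_young t z)%R (mu t) +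
     bracket (fun z => phi (t, z) * (1 - in_young t z))%R (mu t))%E.
  rewrite [in RHS]/bracket -integralD_EFin; [|exact: measurable_quadrant
    |exact: bounded_bracket_integrable b1|exact: bounded_bracket_integrable b2].
  by apply: bracket_eq => z _; rewrite -mulrDr addrC subrK mulr1.
rewrite !bracket_old; [|exact: mphi..].
(* At time 0 every point of the quadrant is old, so the initial term of [mu] passes unchanged to the
   old part. *)
rewrite (@bracket_eq _ (mu 0) (fun z => phi (0, z) * (1 - in_young 0 z))
  (fun z => phi (0, z))); last first.
  by move=> z /quadrantP[_ z2]; rewrite /in_young ltNge z2/= subr0 mulr1.
have -> : (\int[leb]_(s in I t)
    bracket (fun z => phi (s, z) * hazard g (mu s) z)%R (old_part (mu s) s))%E =
    time_bracket mu t (fun p => phi p * hazard g (mu p.1) p.2 * (1 - in_young p.1 p.2))%R.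
  apply: eq_integral => s /set_mem/=; rewrite in_itv/= => /andP[s0 _].
  apply: bracket_old; apply: measurable_funM; first exact: mphi.
  exact: measurable_hazard.
have -> : (\int[leb]_(s in I t)
    bracket (transport (mu s) phi s) (old_part (mu s) s))%E =
    time_bracket mu t (fun p => transport (mu p.1) phi p.1 p.2 * (1 - in_young p.1 p.2))%R.
  apply: eq_integral => s /set_mem/=; rewrite in_itv/= => /andP[s0 _].
  by apply: bracket_old; exact: measurable_transport.
move: md yd; rewrite ebt.
have -> : (\int[leb]_(s in I t)
    bracket (fun z => phi (s, z) * hazard g (mu s) z)%R (mu s))%E =
    time_bracket mu t (fun p => phi p * hazard g (mu p.1) p.2)%R by [].
have -> : (\int[leb]_(s in I t) bracket (transport (mu s) phi s) (mu s))%E =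
    time_bracket mu t (fun p => transport (mu p.1) phi p.1 p.2) by [].
rewrite eh et.
exact: ereal_subtract_balance.
Qed.

Lemma old_hazard_lty t : 0 <= t ->
  (\int[leb]_(s in I t) bracket (hazard g (mu s)) (old_part (mu s) s) < +oo)%E.
Proof.
move=> t0; have cap := @mass_capP t; have [_ [_ _ sc _]] := mu_solution.
apply: le_lt_trans (sc t t0); have mh := measurable_hazard_domain t0.
have my := @measurable_in_young_domain t.
have o1 s z : 0 <= 1 - in_young s z <= 1.
  by rewrite /in_young; case: ltP => _; rewrite ?subrr ?subr0 ?lexx ?ler01.
rewrite [leLHS](_ : _ = \int[leb]_(s in I t)
  bracket (fun z => hazard g (mu s) z * (1 - in_young s z))%R (mu s))%E; last first.
  by apply: eq_integral => s _; apply: bracket_old; exact: measurable_hazard.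
apply: ge0_le_integral => //.
- move=> s _; apply: bracket_ge0 => z qz.
  by rewrite mulr_ge0 ?hazard_ge0//; have /andP[] := o1 s z.
- apply: (measurable_bracket mu_cadlag t0 cap
    (F := fun p => hazard g (mu p.1) p.2 * (1 - in_young p.1 p.2))).
  by apply: measurable_funM => //; apply: measurable_funB => //; exact: measurable_cst.
- exact: (measurable_bracket mu_cadlag t0 cap (F := fun p => hazard g (mu p.1) p.2)).
- move=> s _; apply: le_bracket.
  + apply: measurable_funM; first exact: measurable_hazard.
    by apply: measurable_funB; [exact: measurable_cst|exact: measurable_in_young].
  + exact: measurable_hazard.
  + by move=> z qz; rewrite mulr_ge0 ?hazard_ge0//; have /andP[] := o1 s z.
  + by move=> z qz; rewrite ler_piMr ?hazard_ge0//; have /andP[] := o1 s z.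
Qed.

End fluid_solution.

Theorem theorem3p5 (R : realType) (lambda0 : R) (lambda0_gt0 : 0 < lambda0)
    (g : R * R -> R) (g_density : is_density g)
    (g_locally_bounded : locally_bounded_in_Ug g)
    (Sg_C1 : C1_quadrant (Sg g))
    (mu : R -> MFplus R) (mu_solution : solution lambda0 g mu)
    (nu : R -> MFplus R) (nu_unique : unique_null_solution lambda0 g nu) :
  exists xi : R -> MFplus R,
    (forall t : R, 0 <= t -> forall A : set (plane R), measurable A ->
       (xi t A = mu t A - nu t A)%E) /\
    [/\ forall t : R, 0 <= t -> xi t (Ugc g) = 0%E,
        forall t : R, 0 <= t -> ymarginal_ac (xi t),
        forall t : R, 0 <= t ->
          (\int[lebesgue_measure]_(s in `[0%R, t])
             bracket (hazard g (mu s)) (xi s) < +oo)%E &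
        forall (t : R) (phi : R * (R * R) -> R), 0 <= t -> C1c_octant phi ->
          (bracket (fun z => phi (t, z)) (xi t) =
           bracket (fun z => phi (0%R, z)) (xi 0%R)
           - \int[lebesgue_measure]_(s in `[0%R, t])
               bracket (fun z => phi (s, z) * hazard g (mu s) z)%R (xi s)
           + \int[lebesgue_measure]_(s in `[0%R, t])
               bracket (transport (mu s) phi s) (xi s))%E].
Proof.
have l0 := ltW lambda0_gt0; have [_ _ nuE] := nu_unique.
have yE := nuE _ (young_solution l0 g_density Sg_C1 mu_solution)
  (young_null_at_0 mu).
have [_ [sa sb sc _]] := mu_solution.
(* Nonnegativity is built into the witness, a restriction of [mu]. That it equals the difference
   with [nu] uses uniqueness and finite mass, which justifies subtracting the measure of the young
   part. *)
exists (fun s => old_part (mu s) s); split; last split.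
- move=> t t0 A mA; rewrite -(yE t t0 A mA) /old_part /young_part !restrE -setDE.
  by rewrite measureD//; [exact: measurable_young|exact: mf_lty].
- by move=> t t0; apply: restr_eq0; [exact: measurable_Ugc|exact: sa].
- by move=> t t0; apply: restr_ymarginal_ac; exact: sb.
- exact: (old_hazard_lty l0 g_density Sg_C1 mu_solution).
- by move=> t phi t0 Cphi; exact: (old_dynamics l0 g_density Sg_C1 mu_solution).
Qed.
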